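(* Let $\psi: \mathbb{R}^n \to \mathbb{R} \cup \{+\infty\}$ be an essentially-continuous convex function with $0 < \int_{\mathbb{R}^n} e^{-\psi} < +\infty$. Then the moment measure of $\psi$ is not supported in a hyperplane (whether or not the hyperplane passes through the origin), and its barycenter lies at the origin.
   Context: Convex functions are allowed to take the value $+\infty$, with $e^{-\infty}=0$. A convex function $\psi:\mathbb{R}^n\to\mathbb{R}\cup\{+\infty\}$ is differentiable almost everywhere in the interior of the convex set $\{\psi<+\infty\}$. Moment measure: for a convex $\psi:\mathbb{R}^n\to\mathbb{R}\cup\{+\infty\}$ with $0<\int_{\mathbb{R}^n} e^{-\psi}<+\infty$, the moment measure of $\psi$ is the Borel measure $\mu$ on $\mathbb{R}^n$ that is the push-forward of the measure $e^{-\psi(x)}\,dx$ under the map $\nabla\psi$, i.e. $\int b\,d\mu=\int b(\nabla\psi(x))e^{-\psi(x)}\,dx$ for every Borel function $b$ that is nonnegative or in $L^1(\mu)$. Essential continuity: a convex function $\psi:\mathbb{R}^n\to\mathbb{R}\cup\{+\infty\}$ is essentially-continuous if it is lower semi-continuous and the set of points where $\psi$ is discontinuous has zero $\mathcal{H}^{n-1}$-measure, where $\mathcal{H}^{n-1}$ is the $(n-1)$-dimensional Hausdorff measure. (Continuity at a point where $\psi=+\infty$ means that the limit of $\psi$ at this point is $+\infty$.) That the barycenter lies at the origin includes the assertion that $\mu$ has finite first moments. *)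

(* Defs.v *)
From HB Require Import structures.
From mathcomp Require Import all_boot all_order all_algebra.
From mathcomp Require Import all_classical all_reals all_analysis.
From mathcomp Require Import measurable_realfun.

Set Implicit Arguments.
Unset Strict Implicit.
Unset Printing Implicit Defensive.

Import Order.TTheory GRing.Theory Num.Theory.
Import numFieldNormedType.Exports.

Local Open Scope classical_set_scope.
Local Open Scope ring_scope.

Fact rV_display : measure_display. Proof. exact: default_measure_display. Qed.

Section borel_rV.
Context (R : realType) (n : nat).

Let borel : set (set 'rV[R]_n) := <<s @open 'rV[R]_n >>.

Let borel0 : borel set0. Proof. exact: sigma_algebra0. Qed.

Let borelC A : borel A -> borel (~` A). Proof. exact: sigma_algebraC. Qed.

Let borelU (F : (set 'rV[R]_n)^nat) :
  (forall i, borel (F i)) -> borel (\bigcup_i F i).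
Proof. exact: sigma_algebra_bigcup. Qed.

HB.instance Definition _ := @isMeasurable.Build rV_display
  'rV[R]_n borel borel0 borelC borelU.

Lemma open_measurable_rV (A : set 'rV[R]_n) : open A -> measurable A.
Proof. exact: sub_sigma_algebra. Qed.

Lemma measurable_coord (i : 'I_n) :
  measurable_fun [set: 'rV[R]_n] (fun x : 'rV[R]_n => x ord0 i).
Proof.
apply: (measurability _ (RGenOpens.measurableE R)) => _ [_ [a [b ->] <-]].
rewrite setTI; apply: open_measurable_rV.
apply: open_comp; last exact: interval_open.
by move=> x _; exact: coord_continuous.
Qed.

End borel_rV.

Section measurable_rowP.
Context (R : realType) (n : nat) d (T : measurableType d).

Let ball_rat (qk : 'rV[rat]_n * nat) : set 'rV[R]_n :=
  ball (map_mx ratr qk.1 : 'rV[R]_n) qk.2.+1%:R^-1.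

Let open_bigcup_ball (O : set 'rV[R]_n) : open O ->
  O = \bigcup_(qk in [set qk | ball_rat qk `<=` O]) ball_rat qk.
Proof.
move=> oO; apply/seteqP; split; last by move=> x [qk /= + xqk]; exact.
move=> x Ox; have [e /= e0 xeO] : exists2 e : R, 0 < e & ball x e `<=` O.
  by move/nbhs_ballP : (open_nbhs_nbhs (conj oO Ox)) => [e /= e0 xeO]; exists e.
have [k ke] : exists k, k.+1%:R^-1 < e / 2.
  exists (Num.truncn (e / 2)^-1); rewrite invf_plt ?posrE ?divr_gt0//.
  exact: truncnS_gt.
have k0 : 0 < k.+1%:R^-1 :> R by rewrite invr_gt0.
have rat_near (i : 'I_n) :
    {q : rat | ball (ratr q : R) k.+1%:R^-1 (x ord0 i)}.
  apply: cid; have [q] : exists q : rat,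
      ratr q \in `]x ord0 i - k.+1%:R^-1, x ord0 i + k.+1%:R^-1[%R.
    by apply: rat_in_itvoo; rewrite ltrD2l gtrN.
  rewrite in_itv/= => /andP[xq qx]; exists q.
  by rewrite /ball/= distrC ltr_distlC xq qx.
pose q : 'rV[rat]_n := \row_i sval (rat_near i).
have qx : ball_rat (q, k) x.
  by split=> // i j; rewrite !mxE (ord1 i); exact: (svalP (rat_near j)).
exists (q, k) => //= y qy; apply: xeO.
apply: (@le_ball _ _ _ (k.+1%:R^-1 + k.+1%:R^-1)).
  by rewrite [leRHS]splitr lerD// ltW.
by apply: ball_triangle qy; exact: ball_sym.
Qed.

Lemma measurable_fun_rowP (f : T -> 'rV[R]_n) :
  (forall i, measurable_fun [set: T] (fun t => f t ord0 i)) ->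
  measurable_fun [set: T] f.
Proof.
move=> mf; apply: (@measurability _ _ _ _ _ _ (@open 'rV[R]_n)) => //.
move=> _ [U oU <-]; rewrite setTI (open_bigcup_ball oU) preimage_bigcup.
rewrite bigcup_mkcond; apply: countable_bigcupT_measurable => // -[q k].
case: ifPn => // _.
have -> : f @^-1` ball_rat (q, k) =
    \bigcap_(i in [set: 'I_n])
      ((fun t => f t ord0 i) @^-1` ball (ratr (q ord0 i) : R) k.+1%:R^-1).
  apply/seteqP; split => t /=.
    by move=> [_ qf] i _; have := qf ord0 i; rewrite mxE.
  move=> qf; split=> [|i j]; first by rewrite invr_gt0.
  by rewrite mxE (ord1 i); exact: qf.
apply: fin_bigcap_measurable => // i _; rewrite -[X in measurable X]setTI.
by apply: mf => //; exact: measurable_ball.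
Qed.

End measurable_rowP.

Section lebesgue_rV.
Context (R : realType).

Definition row_cons n (p : R * 'rV[R]_n) : 'rV[R]_n.+1 :=
  row_mx (p.1%:M : 'rV[R]_1) p.2.

Lemma row_cons0 n p : @row_cons n p ord0 ord0 = p.1.
Proof.
have -> : ord0 = lshift n (ord0 : 'I_1) :> 'I_n.+1 by exact/val_inj.
by rewrite (row_mxEl (p.1%:M : 'rV[R]_1)) mxE.
Qed.

Lemma row_consS n p (i : 'I_n) :
  @row_cons n p ord0 (lift ord0 i) = p.2 ord0 i.
Proof.
have -> : lift ord0 i = rshift 1 i :> 'I_n.+1 by exact/val_inj.
by rewrite (row_mxEr (p.1%:M : 'rV[R]_1)).
Qed.

Lemma measurable_row_cons n : measurable_fun [set: R * 'rV[R]_n] (@row_cons n).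
Proof.
apply: measurable_fun_rowP => i; case: (unliftP ord0 i) => [j|] ->.
  under eq_fun do rewrite row_consS.
  apply: (measurableT_comp (measurable_coord j)).
  exact: measurable_snd.
under eq_fun do rewrite row_cons0.
exact: measurable_fst.
Qed.

Section step.
Context (n : nat) (mu : {sigma_finite_measure set 'rV[R]_n -> \bar R}).
Local Open Scope ereal_scope.

Definition lebesgue_rV_step : set 'rV[R]_n.+1 -> \bar R :=
  pushforward (@lebesgue_measure R \x mu) (@row_cons n).

Let step0 : lebesgue_rV_step set0 = 0.
Proof. by rewrite /lebesgue_rV_step /pushforward preimage_set0 measure0. Qed.

Let step_ge0 A : 0 <= lebesgue_rV_step A.
Proof. by apply: integral_ge0 => *; exact: measure_ge0. Qed.

Let step_sigma_additive : semi_sigma_additive lebesgue_rV_step.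
Proof.
have mcons A : measurable A -> measurable (@row_cons n @^-1` A).
  by move=> mA; rewrite -[X in measurable X]setTI; exact: measurable_row_cons.
move=> F mF tF mUF; rewrite /lebesgue_rV_step /pushforward preimage_bigcup.
apply: measure_semi_sigma_additive => [k||]; first exact: mcons.
- apply/trivIsetP => /= i j _ _ ij; rewrite -preimage_setI.
  by move/trivIsetP : tF => /(_ _ _ _ _ ij) ->//; rewrite preimage_set0.
- by rewrite -preimage_bigcup; exact: mcons.
Qed.

HB.instance Definition _ := isMeasure.Build _ _ _ lebesgue_rV_step
  step0 step_ge0 step_sigma_additive.

Lemma lebesgue_rV_stepE (A : 'I_n.+1 -> set R) :
  (forall i, measurable (A i)) ->
  lebesgue_rV_step [set x | forall i, A i (x ord0 i)] =
  lebesgue_measure (A ord0) *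
  mu [set x | forall i, A (lift ord0 i) (x ord0 i)].
Proof.
move=> mA.
pose B := [set x : 'rV[R]_n | forall i, A (lift ord0 i) (x ord0 i)].
have mB : measurable B.
  rewrite [X in measurable X](_ : _ = \bigcap_(i in [set: 'I_n])
      ((fun x : 'rV[R]_n => x ord0 i) @^-1` A (lift ord0 i))); last first.
    by apply/seteqP; split => x /= xA i; [move=> _|]; exact: xA.
  apply: fin_bigcap_measurable => // i _; rewrite -[X in measurable X]setTI.
  by apply: measurable_coord => //; exact: mA.
rewrite /lebesgue_rV_step /pushforward.
have -> : @row_cons n @^-1` [set x | forall i, A i (x ord0 i)] = A ord0 `*` B.
  apply/seteqP; split => p /= pA.
    split=> [|i]; first by rewrite -(row_cons0 p); exact: pA.
    by rewrite -row_consS; exact: pA.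
  move=> i; case: (unliftP ord0 i) => [j|] ->.
    by rewrite row_consS; exact: pA.2.
  by rewrite row_cons0; exact: pA.1.
exact (product_measure1E lebesgue_measure mu (mA ord0) mB).
Qed.

Let lebesgue_rV_step_sigma_finite : sigma_finite setT lebesgue_rV_step.
Proof.
have /sigma_finiteP[F [TF ndF Foo]] := sigma_finiteT (@lebesgue_measure R).
have /sigma_finiteP[G [TG ndG Goo]] := sigma_finiteT mu.
pose uncons (x : 'rV[R]_n.+1) := (x ord0 ord0, \row_i x ord0 (lift ord0 i)).
have unconsK p : uncons (row_cons p) = p.
  case: p => a v; rewrite /uncons row_cons0; congr pair.
  by apply/rowP => i; rewrite mxE row_consS.
have muncons : measurable_fun [set: 'rV[R]_n.+1] uncons.
  apply: measurable_fun_pair; first exact: measurable_coord.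
  apply: measurable_fun_rowP => i; under eq_fun do rewrite mxE.
  exact: measurable_coord.
exists (fun k => uncons @^-1` (F k `*` G k)).
  rewrite -preimage_bigcup; apply/seteqP; split => // x _.
  have [k _ Fkx] : (\bigcup_k F k) (uncons x).1 by rewrite -TF.
  have [l _ Glx] : (\bigcup_k G k) (uncons x).2 by rewrite -TG.
  exists (maxn k l) => //; split.
    by move: Fkx; exact/subsetPset/ndF/leq_maxl.
  by move: Glx; exact/subsetPset/ndG/leq_maxr.
move=> k; have [mF Fk] := Foo k; have [mG Gk] := Goo k; split.
  by rewrite -[X in measurable X]setTI; apply: muncons => //; exact: measurableX.
rewrite /lebesgue_rV_step /pushforward.
have -> : @row_cons n @^-1` (uncons @^-1` (F k `*` G k)) = F k `*` G k.
  by rewrite -comp_preimage (_ : _ \o _ = id) ?preimage_id//; exact/funext.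
have -> := product_measure1E lebesgue_measure mu mF mG.
by rewrite lte_mul_pinfty// ge0_fin_numE.
Qed.

HB.instance Definition _ := Measure_isSigmaFinite.Build _ _ _
  lebesgue_rV_step lebesgue_rV_step_sigma_finite.

End step.

Fixpoint lebesgue_rV n : {sigma_finite_measure set 'rV[R]_n -> \bar R} :=
  match n with
  | 0 => dirac (0 : 'rV[R]_0)
  | n'.+1 => lebesgue_rV_step (lebesgue_rV n')
  end.

Lemma lebesgue_rV_box n (A : 'I_n -> set R) :
  (forall i, measurable (A i)) ->
  lebesgue_rV n [set x | forall i, A i (x ord0 i)] =
  (\prod_(i < n) lebesgue_measure (A i))%E.
Proof.
elim: n A => [|n IH] A mA /=.
  by rewrite big_ord0 diracE mem_set// => -[].
rewrite big_ord_recl lebesgue_rV_stepE//; congr (_ * _)%E.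
exact: (IH (fun i => A (lift ord0 i))).
Qed.

End lebesgue_rV.

Section euclidean.
Context (R : realType) (n : nat).
Implicit Types (x y theta : 'rV[R]_n) (A U : set 'rV[R]_n).

Definition dotr x y : R := \sum_(i < n) x ord0 i * y ord0 i.

(* The library norm `|x| on 'rV[R]_n is the sup norm. *)
Definition enorm x : R := Num.sqrt (dotr x x).

Definition hyperplane theta (c : R) : set 'rV[R]_n :=
  [set y | dotr theta y = c].

Local Open Scope ereal_scope.

(* The maximum with 0 only matters for the empty set. *)
Definition ediam U : \bar R :=
  maxe 0 (ereal_sup [set (enorm (p.1 - p.2)%R)%:E | p in U `*` U]).

(* Since x `^ 0 = 1 for all x, the empty set has to be treated apart when
   s = 0; with this convention the 0-dimensional Hausdorff measure is the
   counting measure. *)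
Definition hausdorff_weight (s : R) U : \bar R :=
  if U == set0 then 0 else ediam U `^ s.

Definition hausdorff_premeasure (s delta : R) A : \bar R :=
  ereal_inf [set \sum_(k <oo) hausdorff_weight s (U k) |
    U in [set U : (set 'rV[R]_n)^nat |
      A `<=` \bigcup_k U k /\ forall k, ediam (U k) <= delta%:E]].

(* No dimensional constant in front: only null sets are used. *)
Definition hausdorff_measure (s : R) A : \bar R :=
  ereal_sup [set hausdorff_premeasure s delta A | delta in [set e | (0 < e)%R]].

End euclidean.

Section moment_measure.
Context (R : realType) (n : nat).
Local Open Scope ereal_scope.
Implicit Types psi : 'rV[R]_n -> \bar R.

Definition convex_efun psi : Prop :=
  (forall x, psi x != -oo) /\
  (forall (x y : 'rV[R]_n) (t : R), (0 <= t <= 1)%R ->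
     psi (t *: x + (1 - t) *: y)%R <= t%:E * psi x + (1 - t)%:E * psi y).

(* Continuity is for the topology of the extended line: where psi x = +oo, it
   means that psi tends to +oo at x. *)
Definition essentially_continuous psi : Prop :=
  lower_semicontinuous psi /\
  hausdorff_measure n.-1%:R [set x | ~ {for x, continuous psi}] = 0.

Definition edifferentiable psi (x : 'rV[R]_n) : Prop :=
  (\forall y \near x, psi y \is a fin_num) /\ differentiable (fine \o psi) x.

(* Set to 0 where psi is not differentiable; for a convex psi, these points
   are negligible for the measure with density expeR (- psi). *)
Definition gradient psi (x : 'rV[R]_n) : 'rV[R]_n :=
  if pselect (edifferentiable psi x)
  then (\row_i 'D_(delta_mx ord0 i) (fine \o psi) x)%R
  else 0%R.

Definition exp_measure psi (A : set 'rV[R]_n) : \bar R :=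
  \int[lebesgue_rV R n]_(x in A) expeR (- psi x).

Definition moment_measure psi : set 'rV[R]_n -> \bar R :=
  pushforward (exp_measure psi) (gradient psi).

Implicit Types mu : set 'rV[R]_n -> \bar R.

Definition supported_in mu (A : set 'rV[R]_n) : Prop := mu (~` A) = 0.

Definition finite_first_moment mu : Prop :=
  mu.-integrable [set: 'rV[R]_n] (fun y => (enorm y)%:E).

Definition barycenter mu : 'rV[R]_n :=
  \row_i ((fine (mu [set: 'rV[R]_n]))^-1 *
          fine (\int[mu]_y (y ord0 i)%:E))%R.

End moment_measure.

(* Main.v *)
Require Import Defs.
From HB Require Import structures.
From mathcomp Require Import all_boot all_order all_algebra.
From mathcomp Require Import all_classical all_reals all_analysis.
From mathcomp Require Import measurable_realfun ring lra.
Import Order.TTheory GRing.Theory Num.Theory.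
Import numFieldNormedType.Exports.
Local Open Scope classical_set_scope.
Local Open Scope ring_scope.

(** On a line in a coordinate direction [e_i] that meets no discontinuity point of
    [psi], the function [f = exp (- psi)] is continuous and unimodal, so the
    integral of [|f'|] is at most twice its maximum, and [f g] integrates by parts
    without boundary term for every bounded Lipschitz [g].  Since the projection
    along [e_i] of an [H^(n-1)]-null set is Lebesgue null, almost every line is of
    this kind, and Fubini's theorem gives
      [\int d_i psi g(x_j) exp (- psi) = delta_ij \int g'(x_j) exp (- psi)].
    The required integrability of the maximum over lines follows from
    log-concavity: if [f >= c] on a ball around [x0], then the values of [f] at the
    midpoints of [x] with that ball dominate a multiple of [f x], so the maximum
    over the line above [y] is bounded by a multiple of the integral of [f] over
    the line above [(y + y0) / 2].
    Taking [g = 1] shows that the barycenter is the origin.  If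
    [<theta, grad psi> = c] almost everywhere, then [g = 1] gives [c = 0], and
    [g = atan] with [theta_j <> 0] gives
      [0 = theta_j \int exp (- psi) / (1 + x_j ^ 2)], which is absurd.
    The case [g = 1] applied to left and right derivatives also shows that they
    agree almost everywhere, whence the almost everywhere differentiability of
    [psi] on its domain. *)

Set Implicit Arguments.
Unset Strict Implicit.
Unset Printing Implicit Defensive.

(** * Lebesgue measure on row vectors, sliced along a coordinate *)

Section insert_coordinate.
Context (R : realType) (m : nat).

(** One-sided derivatives carry the argument. They are limsups of quotients along the steps
    [1 / (k + 1)] or [- 1 / (k + 1)], hence defined everywhere and measurable, and sequences of
    quotients suit Fatou's lemma and dominated convergence. Integration by parts comes from
    translation invariance: [u(t + h) - u(t)] integrates to 0, and so does the limit of the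
    quotients when [u] is Lipschitz with bounded support. The obstacle is that [f] need not be
    Lipschitz on a line: it can leave 0 like a square root. The truncation [max(f - e, 0)] is
    Lipschitz with bounded support, and [e] tends to 0 afterwards, under a bound made of [|f'|] and
    [f]. Continuity on the line excludes a jump of [f] at an end of its domain, the only possible
    source of a boundary term. Only the product of [d_i psi] with [exp (- psi)] is known to be
    integrable, so test functions have to be bounded. Formally [g(t) = t] would detect [theta_j];
    [atan] keeps its positive derivative and is bounded. *)

Definition ins (i : 'I_m.+1) (p : R * 'rV[R]_m) : 'rV[R]_m.+1 :=
  \row_j (if unlift i j is Some k then p.2 ord0 k else p.1).

Lemma ins_id i p : ins i p ord0 i = p.1.
Proof. by rewrite mxE unlift_none. Qed.

Lemma ins_lift i p k : ins i p ord0 (lift i k) = p.2 ord0 k.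
Proof. by rewrite mxE liftK. Qed.

Definition del (i : 'I_m.+1) (x : 'rV[R]_m.+1) : 'rV[R]_m :=
  \row_k x ord0 (lift i k).

Lemma del_ins i p : del i (ins i p) = p.2.
Proof. by apply/rowP => k; rewrite mxE ins_lift. Qed.

Lemma measurable_ins i : measurable_fun [set: R * 'rV[R]_m] (ins i).
Proof.
apply: measurable_fun_rowP => j; case: (unliftP i j) => [k|] ->.
  under eq_fun do rewrite ins_lift.
  exact: (measurableT_comp (measurable_coord k) measurable_snd).
under eq_fun do rewrite ins_id.
exact: measurable_fst.
Qed.

End insert_coordinate.

Section boxes.
Context (R : realType) (n : nat).

Lemma ler_coord_norm (x : 'rV[R]_n) i : `|x ord0 i| <= `|x|.
Proof.
rewrite [leRHS]/Num.norm/= mx_normrE.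
exact: (le_bigmax _ (fun j => `|x j.1 j.2|) (ord0, i)).
Qed.

Definition boxes : set (set 'rV[R]_n) :=
  [set B | exists2 A : 'I_n -> set R, (forall i, measurable (A i)) &
    B = [set x : 'rV[R]_n | forall i, A i (x ord0 i)]].

Lemma measurable_box (A : 'I_n -> set R) : (forall i, measurable (A i)) ->
  measurable [set x : 'rV[R]_n | forall i, A i (x ord0 i)].
Proof.
move=> mA; rewrite [X in measurable X](_ : _ = \bigcap_(i in [set: 'I_n])
    ((fun x : 'rV[R]_n => x ord0 i) @^-1` A i)); last first.
  by apply/seteqP; split => x /= xA i; [move=> _|]; exact: xA.
apply: fin_bigcap_measurable => // i _; rewrite -[X in measurable X]setTI.
by apply: measurable_coord => //; exact: mA.
Qed.

Lemma setI_closed_boxes : setI_closed boxes.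
Proof.
move=> _ _ [A mA ->] [B mB ->]; exists (fun i => A i `&` B i).
  by move=> i; exact: measurableI.
apply/seteqP; split => x /=; first by move=> [xA xB] i; split.
by move=> xAB; split => i; have [] := xAB i.
Qed.

(* Coordinates are measurable for the sigma-algebra generated by boxes, hence
   so is the identity, by [measurable_fun_rowP]. *)
Lemma measurable_rVE : measurable = <<s boxes >>.
Proof.
apply/seteqP; split => [A mA|]; last first.
  apply: smallest_sub; first exact: sigma_algebra_measurable.
  by move=> _ [A mA ->]; exact: measurable_box.
have mid : measurable_fun [set: g_sigma_algebraType boxes]
    (id : g_sigma_algebraType boxes -> 'rV[R]_n).
  apply: measurable_fun_rowP => i _ B mB; rewrite setTI.
  apply: sub_sigma_algebra.
  exists (fun j => if j == i then B else setT) => [j|]; first by case: ifP.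
  apply/seteqP; split => x /=; first by move=> Bx j; case: eqP => // ->.
  by move=> /(_ i); rewrite eqxx.
by have := mid measurableT _ mA; rewrite setTI.
Qed.

Definition cube (k : nat) : set 'rV[R]_n :=
  [set x | forall i, ball (0 : R) k%:R (x ord0 i)].

(** Boxes are stable under intersection and generate the Borel sets; the cubes, of finite measure,
    exhaust the space. *)
Lemma rV_measure_unique (m1 m2 : {measure set 'rV[R]_n -> \bar R}) :
  (forall k, (m1 (cube k) < +oo)%E) ->
  (forall A : 'I_n -> set R, (forall i, measurable (A i)) ->
    m1 [set x | forall i, A i (x ord0 i)] =
    m2 [set x | forall i, A i (x ord0 i)]) ->
  forall A, measurable A -> m1 A = m2 A.
Proof.
move=> fm1 m12.
apply: (measure_unique boxes cube).
- exact: measurable_rVE.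
- exact: setI_closed_boxes.
- by move=> k; exists (fun=> ball 0 k%:R) => // i; exact: measurable_ball.
- apply/seteqP; split => // x _; exists (Num.truncn `|x|).+1 => // i.
  rewrite /ball/= sub0r normrN; apply: le_lt_trans (truncnS_gt _).
  exact: ler_coord_norm.
- by move=> _ [A mA ->]; exact: m12.
- exact: fm1.
Qed.

End boxes.

Section fubini_rV.
Context (R : realType).
Local Open Scope ereal_scope.
Local Notation leb := (@lebesgue_measure R).

Lemma lebesgue_rV_box_fin n (k : nat) :
  lebesgue_rV R n (@cube R n k) < +oo.
Proof.
rewrite (lebesgue_rV_box (A := fun=> ball (0 : R)%R k%:R)); last first.
  by move=> j; exact: measurable_ball.
rewrite ltey_eq prode_fin_num// => j _.
by rewrite lebesgue_measure_ball.
Qed.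

Context (m : nat) (i : 'I_m.+1).
Local Notation lebm := (lebesgue_rV R m).

(** Both measures give a box the product of the measures of its sides. This frees the first
    coordinate from the special role that the recursive definition of [lebesgue_rV] gives it: any
    coordinate [i] can be split off. *)
Lemma lebesgue_rV_ins (A : set 'rV[R]_m.+1) : measurable A ->
  lebesgue_rV R m.+1 A = pushforward (leb \x lebm) (ins i) A.
Proof.
have mins : measurable_fun [set: measurableTypeR R * 'rV[R]_m] (@ins R m i).
  exact: measurable_ins.
pose m2 : {measure set 'rV[R]_m.+1 -> \bar R} :=
  measure_function_pushforward__canonical__measure_function_Measure (leb \x lebm) mins.
apply: (@rV_measure_unique R m.+1 (lebesgue_rV R m.+1) m2).
  by move=> k; exact: lebesgue_rV_box_fin.
move=> B mB; apply: (etrans (lebesgue_rV_box mB)); rewrite /m2/= /pushforward.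
pose C := [set y : 'rV[R]_m | forall k, B (lift i k) (y ord0 k)].
have mC : measurable C.
  by apply: (@measurable_box R m (fun k => B (lift i k))) => k; exact: mB.
have -> : ins i @^-1` [set x | forall j, B j (x ord0 j)] = B i `*` C.
  apply/seteqP; split => p /= pB.
    by split=> [|k]; [rewrite -(ins_id i p)|rewrite -(ins_lift i p)]; exact: pB.
  move=> j; case: (unliftP i j) => [k|] ->.
    by rewrite ins_lift; exact: pB.2.
  by rewrite ins_id; exact: pB.1.
apply/esym/(etrans (product_measure1E leb lebm (mB i) mC)).
rewrite [RHS](bigD1_ord i)//; congr (_ * _).
exact: (lebesgue_rV_box (A := fun k => B (lift i k))).
Qed.

Lemma tonelli_rV (f : 'rV[R]_m.+1 -> \bar R) : measurable_fun setT f ->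
  (forall x, 0 <= f x) ->
  \int[lebesgue_rV R m.+1]_x f x = \int[lebm]_y \int[leb]_t f (ins i (t, y)).
Proof.
move=> mf f0.
have mins : measurable_fun [set: measurableTypeR R * 'rV[R]_m] (@ins R m i).
  exact: measurable_ins.
have mfi : measurable_fun [set: measurableTypeR R * 'rV[R]_m] (f \o ins i).
  exact: measurableT_comp.
apply: etrans (fubini_tonelli2 (m1 := leb) (m2 := lebm) _ mfi _); last first.
  by move=> z /=.
apply: etrans (ge0_integral_pushforward mins (leb \x lebm) measurableT mf _).
  by apply: eq_measure_integral => A mA _; exact: lebesgue_rV_ins.
by move=> z _.
Qed.

Lemma measurable_fun_tonelli_rV (f : 'rV[R]_m.+1 -> \bar R) :
  measurable_fun setT f -> (forall x, 0 <= f x) ->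
  measurable_fun setT (fun y => \int[leb]_t f (ins i (t, y))).
Proof.
move=> mf f0.
apply: (@measurable_fun_fubini_tonelli_G _ _ _ _ _ leb (f \o ins i)).
  by apply: measurableT_comp => //; exact: measurable_ins.
by move=> z /=.
Qed.

Lemma measurable_ins_line (y : 'rV[R]_m) :
  measurable_fun [set: R] (fun t => ins i (t, y)).
Proof.
apply: (measurableT_comp (@measurable_ins R m i)).
exact: measurable_fun_pair.
Qed.

Lemma integrable_ins (f : 'rV[R]_m.+1 -> \bar R) :
  (lebesgue_rV R m.+1).-integrable setT f ->
  (leb \x lebm).-integrable setT (f \o ins i).
Proof.
move=> fi; have mf := measurable_int _ fi.
have mins : measurable_fun [set: measurableTypeR R * 'rV[R]_m] (@ins R m i).
  exact: measurable_ins.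
apply/integrableP; split; first exact: measurableT_comp.
case/integrableP: fi => _; rewrite (_ : \int[_]_x `|f x| =
    \int[leb \x lebm]_z `|(f \o ins i) z|)//.
have maf : measurable_fun [set: 'rV[R]_m.+1] (abse \o f) by exact: measurableT_comp.
apply: etrans (ge0_integral_pushforward mins (leb \x lebm) measurableT maf _).
  by apply: eq_measure_integral => A mA _; exact: lebesgue_rV_ins.
by move=> z _ /=.
Qed.

Lemma measurable_fun_fubini_rV (f : 'rV[R]_m.+1 -> \bar R) :
  (lebesgue_rV R m.+1).-integrable setT f ->
  measurable_fun setT (fun y => \int[leb]_t f (ins i (t, y))).
Proof. by move=> /integrable_ins; exact: measurable_fubini_G. Qed.

Lemma fubini_rV (f : 'rV[R]_m.+1 -> \bar R) :
  (lebesgue_rV R m.+1).-integrable setT f ->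
  \int[lebesgue_rV R m.+1]_x f x = \int[lebm]_y \int[leb]_t f (ins i (t, y)).
Proof.
move=> fi; have mf := measurable_int _ fi.
have mins : measurable_fun [set: measurableTypeR R * 'rV[R]_m] (@ins R m i).
  exact: measurable_ins.
have fi' := integrable_ins fi.
apply: etrans (esym (integral21_prod_meas1 fi')).
apply: etrans (integral_pushforward mins mf _ measurableT).
  by apply: eq_measure_integral => A mA _; exact: lebesgue_rV_ins.
exact: fi'.
Qed.

Lemma measurable_del : measurable_fun [set: 'rV[R]_m.+1] (@del R m i).
Proof.
apply: measurable_fun_rowP => k.
by under eq_fun do rewrite mxE; exact: measurable_coord.
Qed.

Lemma negligible_del (N : set 'rV[R]_m) : lebm.-negligible N ->
  (lebesgue_rV R m.+1).-negligible (del i @^-1` N).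
Proof.
move=> [M [mM M0 NM]].
have mdM : measurable (@del R m i @^-1` M).
  by rewrite -[X in measurable X]setTI; exact: measurable_del.
exists (del i @^-1` M); split => //; last by move=> x /= /NM.
rewrite lebesgue_rV_ins// /pushforward.
have -> : ins i @^-1` (del i @^-1` M) = setT `*` M.
  by apply/seteqP; split => p /=; rewrite del_ins// => -[].
have -> := product_measure1E leb lebm measurableT mM.
by apply/eqP; rewrite mule_eq0 M0 eqxx orbT.
Qed.

End fubini_rV.

(** * Affine changes of variables *)

Section affine.
Context (R : realType).
Local Open Scope ereal_scope.
Local Notation leb := (@lebesgue_measure R).

Lemma measurable_affine (a b : R) :
  measurable_fun [set: measurableTypeR R]
    ((fun t => a * t + b)%R : measurableTypeR R -> measurableTypeR R).
Proof.
apply: measurable_funD => //; exact: mulrl_measurable.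
Qed.

Lemma lebesgue_measure_affine (a b : R) (A : set R) : (0 < a)%R -> measurable A ->
  leb A = a%:E * leb ((fun t => a * t + b)%R @^-1` A).
Proof.
move=> a0 mA.
pose m2 : {measure set (measurableTypeR R) -> \bar R} :=
  mscale (NngNum (ltW a0))
   (measure_function_pushforward__canonical__measure_function_Measure leb
     (measurable_affine a b)).
apply: (@lebesgue_measure_unique _ m2) => //= _ [[u v]] _ <-.
rewrite /m2 /mscale/= /pushforward.
have -> : (fun t => a * t + b)%R @^-1` `]u, v]%classic =
    `]((u - b) / a)%R, ((v - b) / a)%R]%classic.
  apply/seteqP; split => t /=; rewrite !in_itv/= ltr_pdivrMr// ler_pdivlMr//;
    by rewrite ltrBlDr lerBrDr (mulrC t).
rewrite !lebesgue_measure_itv/= !lte_fin ltr_pM2r ?invr_gt0// ltrD2r.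
case: ifPn => // _; last by rewrite mule0.
by rewrite -!EFinB -EFinM; congr _%:E; field; rewrite gt_eqF.
Qed.

Lemma ge0_integral_affine (a b : R) (f : R -> \bar R) : (0 < a)%R ->
  measurable_fun setT f -> (forall t, 0 <= f t) ->
  \int[leb]_t f t = a%:E * \int[leb]_t f (a * t + b)%R.
Proof.
move=> a0 mf f0.
pose m1 := measure_function_pushforward__canonical__measure_function_Measure leb
     (measurable_affine a b).
pose m2 : {measure set (measurableTypeR R) -> \bar R} := mscale (NngNum (ltW a0)) m1.
transitivity (\int[m2]_t f t).
  by apply: eq_measure_integral => A mA _; exact: lebesgue_measure_affine.
rewrite ge0_integral_mscale//; congr (_ * _).
by apply: etrans (ge0_integral_pushforward (measurable_affine a b) leb _ mf _) _.
Qed.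

Lemma integral_translation (b : R) (f : R -> \bar R) : measurable_fun setT f ->
  \int[leb]_t f (t + b)%R = \int[leb]_t f t.
Proof.
move=> mf; rewrite [LHS]integralE [RHS]integralE; congr (_ - _).
  rewrite (@ge0_integral_affine 1 b f^\+)//; last exact: measurable_funepos.
  by rewrite mul1e; apply: eq_integral => t _; rewrite !funeposE mul1r.
rewrite (@ge0_integral_affine 1 b f^\-)//; last exact: measurable_funeneg.
by rewrite mul1e; apply: eq_integral => t _; rewrite !funenegE mul1r.
Qed.

(** Needed for the ratio 1/2, which turns an integral over midpoints [(y + y0) / 2] into an integral
    over the whole base. *)
Lemma ge0_integral_affine_rV (a : R) n (b : 'rV[R]_n) (f : 'rV[R]_n -> \bar R) :
  (0 < a)%R -> measurable_fun setT f -> (forall x, 0 <= f x) ->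
  \int[lebesgue_rV R n]_x f x =
  (a ^+ n)%:E * \int[lebesgue_rV R n]_x f (a *: x + b)%R.
Proof.
move=> a0; elim: n b f => [|n IH] b f mf f0.
  rewrite expr0 mul1e; apply: eq_integral => x _; congr f.
  by apply/rowP => -[].
have maff : measurable_fun [set: 'rV[R]_n.+1] (fun x : 'rV[R]_n.+1 => a *: x + b)%R.
  apply: measurable_fun_rowP => k; under eq_fun do rewrite !mxE.
  apply: measurable_funD => //; apply: measurable_funM => //.
  exact: measurable_coord.
have mfa : measurable_fun [set: 'rV[R]_n.+1] (fun x : 'rV[R]_n.+1 => f (a *: x + b)%R).
  exact: measurableT_comp.
rewrite (tonelli_rV ord0 mf f0) (tonelli_rV ord0 mfa)//.
pose b' := del ord0 b.
rewrite (IH b'); last 2 first.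
- exact: measurable_fun_tonelli_rV.
- by move=> y; apply: integral_ge0.
rewrite exprS mulrC EFinM -muleA; congr (_ * _).
rewrite -ge0_integralZl//; last 3 first.
- exact: (@measurable_fun_tonelli_rV R n ord0 (fun x => f (a *: x + b)%R)).
- by move=> y _; apply: integral_ge0.
- by rewrite lee_fin ltW.
apply: eq_integral => y _.
rewrite (@ge0_integral_affine a (b ord0 ord0))//; last first.
  by apply: measurableT_comp => //; exact: measurable_ins_line.
congr (_ * _); apply: eq_integral => t _; congr f.
apply/rowP => j; rewrite !mxE; case: unliftP => [k|] -> /=; rewrite ?mxE//.
Qed.

End affine.

(** * Projections of Hausdorff null sets along a coordinate *)

Section hausdorff_null.
Context (R : realType) (m : nat) (i : 'I_m.+1).
Local Open Scope ereal_scope.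

Lemma ler_coord_enorm n (x : 'rV[R]_n) j : (`|x ord0 j| <= enorm x)%R.
Proof.
rewrite /enorm -[leLHS]ger0_norm// -sqrtr_sqr ler_sqrt ?sqr_ge0//; last first.
  by rewrite sumr_ge0// => k _; rewrite -expr2 sqr_ge0.
rewrite /dotr (bigD1 j)//= real_normK ?num_real// expr2 lerDl.
by rewrite sumr_ge0// => k _; rewrite -expr2 sqr_ge0.
Qed.

(** All points of [U] are within its diameter [d] of one point [p], so the projection lies in a cube
    of side [2 d], of volume [2 ^ m * d ^ m]. The bound on the diameter makes [d] finite. For
    [m = 0] both a nonempty [U] and its box have measure 1. *)
Lemma hausdorff_cover_box (U : set 'rV[R]_m.+1) : ediam U <= 1 ->
  exists B : set 'rV[R]_m, [/\ measurable B, del i @` U `<=` B &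
    lebesgue_rV R m B <= (2 ^+ m)%:E * hausdorff_weight m%:R U].
Proof.
move=> U1; have [->|U0] := eqVneq U set0.
  exists set0; split => //; first by rewrite image_set0.
  by rewrite measure0 /hausdorff_weight eqxx mule0.
have [p Up] : exists p, U p by exact/set0P.
have d0 : 0 <= ediam U by rewrite /ediam le_max lexx.
have dfin : ediam U \is a fin_num.
  by rewrite ge0_fin_numE// (le_lt_trans U1)// ltry.
pose d := fine (ediam U).
have dE : ediam U = d%:E by rewrite fineK.
have d0' : (0 <= d)%R by rewrite -lee_fin -dE.
have Ud x : U x -> (enorm (x - p) <= d)%R.
  move=> Ux; rewrite -lee_fin -dE /ediam le_max; apply/orP; right.
  by apply: ereal_sup_ubound; exists (x, p).
pose A k : set R := `[(p ord0 (lift i k) - d)%R, (p ord0 (lift i k) + d)%R]%classic.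
exists [set y : 'rV[R]_m | forall k, A k (y ord0 k)]; split.
- by apply: measurable_box => k; exact: measurable_itv.
- move=> _ [x Ux <-] k; rewrite mxE /A/= in_itv/= -ler_distlC distrC.
  apply: le_trans (Ud _ Ux).
  by apply: le_trans (ler_coord_enorm _ (lift i k)); rewrite !mxE.
- rewrite lebesgue_rV_box//; last by move=> k; exact: measurable_itv.
  have AE k : lebesgue_measure (A k) = (2 * d)%:E.
    rewrite lebesgue_measure_itv/= lte_fin.
    case: ifPn => [_|]; first by rewrite -EFinB; congr _%:E; ring.
    by rewrite -leNgt => dd; have -> : d = 0%R by [lra]; rewrite mulr0.
  under eq_bigr do rewrite AE.
  rewrite prodEFin/= big_const_ord iter_mulr_1 /hausdorff_weight.
  rewrite (negbTE U0) dE poweR_EFin powR_mulrn// -EFinM exprMn.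
  exact: lexx.
Qed.

Lemma negligible_hausdorff_null (D : set 'rV[R]_m.+1) :
  hausdorff_measure m%:R D = 0 ->
  (lebesgue_rV R m).-negligible (del i @` D).
Proof.
move=> D0.
have H (e : R) : (0 < e)%R -> exists W : set 'rV[R]_m, [/\ measurable W,
    del i @` D `<=` W & lebesgue_rV R m W <= e%:E].
  move=> e0.
  (* Covers of mesh 1 are fine enough: the premeasure at any mesh is below the supremum, which is 0.
     The factor [2 ^+ m] lost in passing to boxes is paid for in advance. *)
  have : hausdorff_premeasure m%:R 1 D <= 0.
    by rewrite -D0; apply: ereal_sup_ubound; exists 1%R => //=.
  have e0' : 0 < (e / 2 ^+ m)%:E by rewrite lte_fin divr_gt0// exprn_gt0.
  move=> /le_lt_trans/(_ e0') /ereal_inf_lt[_ [U [DU U1] <-] Ue].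
  have /choice[B HB] := fun k => hausdorff_cover_box (U1 k).
  have mB k : measurable (B k) by have [] := HB k.
  exists (\bigcup_k B k); split.
  - exact: bigcupT_measurable.
  - move=> _ [x Dx <-]; have [k _ Ukx] := DU _ Dx.
    by exists k => //; have [_ + _] := HB k; apply; exists x.
  - have : lebesgue_rV R m (\bigcup_k B k) <=
        \sum_(k <oo) lebesgue_rV R m (B k).
      by apply: measure_sigma_subadditive => //; exact: bigcupT_measurable.
    move=> /le_trans; apply.
    apply: (@le_trans _ _ (\sum_(k <oo) (2 ^+ m)%:E * hausdorff_weight m%:R (U k))).
      by apply: lee_nneseries => // k _; have [] := HB k.
    rewrite nneseriesZl; last first.
      move=> k _; rewrite /hausdorff_weight; case: ifP => // _; exact: poweR_ge0.
    rewrite -lee_pdivlMl ?exprn_gt0// -EFinM mulrC.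
    exact: ltW.
have H' (k : nat) : exists W : set 'rV[R]_m, [/\ measurable W,
    del i @` D `<=` W & lebesgue_rV R m W <= (k.+1%:R^-1)%:E].
  by apply: H; rewrite invr_gt0.
have /choice[W HW] := H'.
have mI : measurable (\bigcap_k W k).
  by apply: bigcapT_measurable => k; have [] := HW k.
exists (\bigcap_k W k); split => //.
  apply/eqP; rewrite eq_le measure_ge0 andbT.
  apply/lee_addgt0Pr => e e0; rewrite add0e.
  pose k := Num.truncn e^-1.
  have [mW _ We] := HW k.
  apply: (@le_trans _ _ (lebesgue_rV R m (W k))).
    by apply: le_measure; rewrite ?inE//; exact: bigcap_inf.
  apply: (le_trans We); rewrite lee_fin invf_ple ?posrE//.
  exact/ltW/truncnS_gt.
by move=> y Dy k _; have [_ + _] := HW k; apply.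
Qed.

End hausdorff_null.

(** * Convex and log-concave functions of one variable *)

Section one_sided_derivative.
Context (R : realType).
Implicit Types (phi : R -> \bar R) (s : bool).

(** Nonzero increments of constant sign tending to 0, of length at most 1. One boolean covers both
    sides, so that every later statement is proved once for left and right derivatives. *)
Definition step s (k : nat) : R := (-1) ^+ s * k.+1%:R^-1.

Lemma step_neq0 s k : step s k != 0.
Proof. by rewrite mulf_neq0// ?signr_eq0// invr_eq0 pnatr_eq0. Qed.

Lemma norm_step s k : `|step s k| = k.+1%:R^-1.
Proof. by rewrite normrM normr_sign mul1r ger0_norm. Qed.

Lemma norm_step_le1 s k : `|step s k| <= 1.
Proof. by rewrite norm_step invf_le1// ler1n. Qed.

Lemma cvg_step s : step s @ \oo --> (0 : R).
Proof.
rewrite -[X in _ --> X](mulr0 ((-1) ^+ s)).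
by apply: cvgM; [exact: cvg_cst|exact: cvg_harmonic].
Qed.

Definition diff_quot s phi (t : R) (k : nat) : R :=
  (fine (phi (t + step s k)) - fine (phi t)) / step s k.

(* Right derivative for [s = false], left derivative for [s = true]. *)
Definition side_deriv s phi (t : R) : R :=
  fine (limn_esup (fun k => (diff_quot s phi t k)%:E)).

Definition convex1 phi : Prop :=
  (forall t, phi t != -oo%E) /\
  (forall x y t : R, 0 <= t <= 1 ->
    (phi (t * x + (1 - t) * y)%R <= t%:E * phi x + (1 - t)%:E * phi y)%E).

Variable phi : R -> \bar R.
Hypothesis cphi : convex1 phi.

Local Notation r := (fine \o phi).
Local Notation fin t := (phi t \is a fin_num).

(** With denominators cleared, convexity is within reach of linear arithmetic and the case [a = c]
    is included. Finiteness at [b] says that the domain is an interval. *)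
Lemma convex1_chord (a b c : R) : a <= b -> b <= c -> fin a -> fin c ->
  fin b /\ r b * (c - a) <= (c - b) * r a + (b - a) * r c.
Proof.
case: cphi => phiN cvx ab bc fa fc.
have [ac|] := ltP a c; last first.
  move=> ca; have bE : b = a by lra.
  have cE : c = a by lra.
  by rewrite bE cE; split => //; lra.
pose t := (c - b) / (c - a).
have t01 : 0 <= t <= 1.
  by rewrite divr_ge0 ?subr_ge0//= ?(ltW ac)// ler_pdivrMr ?subr_gt0//; lra.
have bE : b = t * a + (1 - t) * c by rewrite /t; field; rewrite subr_eq0 gt_eqF.
have := cvx a c t t01; rewrite -bE.
rewrite -(fineK fa) -(fineK fc) -!EFinM -EFinD => H.
have fb : fin b.
  by rewrite fin_numE phiN/= -ltey (le_lt_trans H)// ltry.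
split => //; move: H; rewrite -(fineK fb) lee_fin => H.
have := ler_wpM2r (_ : 0 <= c - a) H; rewrite subr_ge0 => /(_ (ltW ac)).
move=> /le_trans; apply; rewrite le_eqVlt; apply/orP; left; apply/eqP.
by rewrite /t /=; field; rewrite subr_eq0 gt_eqF.
Qed.

Section at_point.
Variable t : R.
Hypothesis ft : \forall u \near t, fin u.

Let near_fin : exists2 e : R, 0 < e & forall u, `|u - t| <= e -> fin u.
Proof.
have /nbhs_ballP[e /= e0 te] := ft.
exists (e / 2); first by rewrite divr_gt0.
move=> u ut; apply: te; rewrite /ball/= distrC.
by apply: (le_lt_trans ut); rewrite gtr_pMr// invf_lt1// ltr1n.
Qed.

(** Outward slope: [d] is a distance on side [s]. In this form the slope is nondecreasing in [d] on
    either side, and two slopes on opposite sides have a nonnegative sum. *)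
Let slope s (d : R) : R := (r (t + (-1) ^+ s * d) - r t) / d.

Let diff_quotE s k : diff_quot s phi t k = (-1) ^+ s * slope s k.+1%:R^-1.
Proof. by rewrite /diff_quot /slope /step invfM invr_sign mulrCA. Qed.

Let slope_nd s (d e : R) : 0 < d -> d <= e -> fin (t + (-1) ^+ s * e) -> fin t ->
  slope s d <= slope s e.
Proof.
move=> d0 de fe ft0; have e0 : 0 < e by lra.
rewrite /slope ler_pdivrMr// mulrAC ler_pdivlMr//.
case: s fe => /=; rewrite ?expr1 ?expr0 ?mulN1r ?mul1r => fe.
  have [||_] := @convex1_chord (t - e) (t - d) t _ _ fe ft0; [lra|lra|rewrite /=; lra].
have [||_] := @convex1_chord t (t + d) (t + e) _ _ ft0 fe; [lra|lra|rewrite /=; lra].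
Qed.

Let slope_lb s (d e : R) : 0 < d -> 0 < e -> fin (t + (-1) ^+ s * d) ->
  fin (t + (-1) ^+ (~~ s) * e) -> - slope (~~ s) e <= slope s d.
Proof.
move=> d0 e0 fd fe.
rewrite /slope ler_pdivlMr// -mulNr mulrAC ler_pdivrMr//.
case: s fd fe => /=; rewrite ?expr1 ?expr0 ?mulN1r ?mul1r => fd fe.
  have [||_] := @convex1_chord (t - d) t (t + e) _ _ fd fe; [lra|lra|rewrite /=; lra].
have [||_] := @convex1_chord (t - e) t (t + d) _ _ fe fd; [lra|lra|rewrite /=; lra].
Qed.

Let near_inv (e : R) : 0 < e -> \forall k \near \oo, k.+1%:R^-1 <= e.
Proof.
move=> e0; have /cvgrPdist_le/(_ _ e0) := @cvg_harmonic R.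
by apply: filterS => k; rewrite /harmonic/= sub0r normrN ger0_norm.
Qed.

(** As the step shrinks, the outward slope decreases and stays above minus a slope on the other
    side, so it converges. The limsup in [side_deriv] is then a finite limit, and [fine] loses
    nothing. *)
Lemma side_deriv_cvg s : diff_quot s phi t @ \oo --> side_deriv s phi t.
Proof.
have [e e0 fe] := near_fin.
have fs s' d : 0 <= d -> d <= e -> fin (t + (-1) ^+ s' * d).
  by move=> d0 de; apply: fe; rewrite addrC addKr normrM normr_sign mul1r ger0_norm.
have ft0 : fin t by apply: fe; rewrite subrr normr0 ltW.
suff /cvg_ex[l /= Hl] : cvgn (diff_quot s phi t).
  rewrite /side_deriv is_cvg_limn_esupE; last first.
    by apply/cvg_ex; exists l%:E; apply/cvg_EFin => //; near=> k.
  suff -> : limn (fun k => (diff_quot s phi t k)%:E) = l%:E by [].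
  by apply/cvg_lim => //; apply: cvg_EFin => //; near=> k.
rewrite (_ : diff_quot s phi t = fun k => (-1) ^+ s * slope s k.+1%:R^-1); last first.
  by apply/funext => k; exact: diff_quotE.
apply: is_cvgMr.
(* Monotonicity starts only where the steps are at most [e], so that both ends of the quotient lie
   in the domain. *)
apply: (@near_nonincreasing_is_cvgn _ _ (- slope (~~ s) e)).
  have [N _ NH] := near_inv e0; exists N => // k /= Nk l kl.
  apply: slope_nd; rewrite ?invr_gt0//.
    by rewrite lef_pV2 ?posrE// ler_nat ltnS.
  by apply: fs => //; apply: NH => /=.
near=> k; apply: slope_lb => //; rewrite ?invr_gt0//; apply: fs => //; last exact: ltW.
by near: k; exact: near_inv.
Unshelve. all: by end_near.
Qed.

Lemma side_deriv_le : side_deriv true phi t <= side_deriv false phi t.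
Proof.
have [e e0 fe] := near_fin.
have fs s' d : 0 <= d -> d <= e -> fin (t + (-1) ^+ s' * d).
  by move=> d0 de; apply: fe; rewrite addrC addKr normrM normr_sign mul1r ger0_norm.
have c1 := @side_deriv_cvg true; have c2 := @side_deriv_cvg false.
rewrite -(cvg_lim _ c1)// -(cvg_lim _ c2)//.
apply: ler_lim; [exact: cvgP c1|exact: cvgP c2|].
near=> k; rewrite !diff_quotE expr1 expr0 mul1r mulN1r.
have ke : k.+1%:R^-1 <= e by near: k; exact: near_inv.
by apply: (@slope_lb false) => //; exact: fs.
Unshelve. all: by end_near.
Qed.

End at_point.

End one_sided_derivative.

(** * Integrals of translation increments and difference quotients *)

Section translation_quotients.
Context (R : realType).
Local Notation leb := (@lebesgue_measure R).

Lemma integrable_bounded_support (u : R -> R) (C B : R) :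
  measurable_fun setT u -> (forall t, `|u t| <= C) ->
  (forall t, B < `|t| -> u t = 0) -> leb.-integrable setT (EFin \o u).
Proof.
move=> mu uC u0.
apply: (@le_integrable _ _ _ leb setT measurableT _
  (fun t => C%:E * (\1_(`[- B, B]%classic) t)%:E)%E).
- exact/measurable_EFinP.
- move=> t _; rewrite -EFinM !abse_EFin lee_fin indicE.
  case: (boolP (t \in _)) => [_|].
    by rewrite mulr1; apply: (le_trans (uC t)); exact: ler_norm.
  rewrite notin_setE/= in_itv/= -ler_norml => /negP; rewrite -ltNge => /u0 ->.
  by rewrite normr0.
- by apply: integrableZl => //; exact: integrable_indic_itv.
Qed.

Lemma lipschitz_measurable (u : R -> R) (K : R) :
  (forall t t', `|u t - u t'| <= K * `|t - t'|) -> measurable_fun setT u.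
Proof.
move=> uK; apply: continuous_measurable_fun => t.
apply/cvgrPdist_lt => e e0.
have K1 : 0 < `|K| + 1 by rewrite ltr_wpDl.
have /cvgrPdist_lt/(_ (e / (`|K| + 1))) := @cvg_id _ (nbhs t).
rewrite divr_gt0// => /(_ isT); apply: filterS => t' tt'.
apply: (le_lt_trans (uK t t')).
rewrite ltr_pdivlMr// in tt'; apply: le_lt_trans tt'.
rewrite mulrC ler_wpM2l//; apply: (le_trans (ler_norm K)).
by rewrite lerDl.
Qed.

(** Translation invariance makes every quotient integrate to 0. The quotients are dominated by [K]
    on [[- (B + 1), B + 1]]: steps have length at most 1, so the support grows by at most 1. *)
Lemma integral_cvg_quotient0 (u v : R -> R) (K B : R) (s : bool) :
  (forall t t', `|u t - u t'| <= K * `|t - t'|) ->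
  (forall t, B < `|t| -> u t = 0) ->
  (forall t, (u (t + step R s k) - u t) / step R s k @[k --> \oo] --> v t) ->
  leb.-integrable setT (EFin \o v) /\ (\int[leb]_t (v t)%:E = 0)%E.
Proof.
move=> uK uB uv.
have mu := lipschitz_measurable uK.
have K0 : 0 <= K.
  by have := uK 0 1; rewrite sub0r normrN normr1 mulr1; exact: le_trans.
(* Comparison with the point [|B| + 1], where [u] vanishes and which is at distance at most
   [2 (|B| + 1)] from [t]. *)
have uC t : `|u t| <= K * (2 * (`|B| + 1)).
  have [Bt|tB] := ltP B `|t|.
    by rewrite (uB _ Bt) normr0 mulr_ge0// mulr_ge0// addr_ge0.
  have := uK t (`|B| + 1).
  rewrite (uB (`|B| + 1)) ?subr0; last first.
    by rewrite ger0_norm ?addr_ge0//; apply: (le_lt_trans (ler_norm B)); rewrite ltrDl.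
  move=> /le_trans; apply; rewrite ler_wpM2l//.
  rewrite (le_trans (ler_normB _ _))// [leRHS]mulr_natl mulr2n lerD//.
    by rewrite (le_trans tB)// (le_trans (ler_norm B))// lerDl.
  by rewrite ger0_norm// addr_ge0.
have iu : leb.-integrable setT (EFin \o u).
  exact: integrable_bounded_support uC uB.
have mut h : measurable_fun [set: R] (fun t : R => u (t + h)).
  by apply: measurableT_comp => //; exact: measurable_funD.
have iut h : `|h| <= 1 -> leb.-integrable setT (fun t : R => (u (t + h))%:E).
  move=> h1; apply: (integrable_bounded_support (B := B + 1)) (mut h) _ _.
    by move=> t; exact: uC.
  move=> t Bt; apply: uB; have := ler_normB (t + h) h; rewrite addrK; lra.
pose q k t := (u (t + step R s k) - u t) / step R s k.
have mq k : measurable_fun setT (q k).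
  by apply: measurable_funM => //; exact: measurable_funB.
have q0 k : (\int[leb]_t (q k t)%:E = 0)%E.
  under eq_integral do rewrite /q mulrC EFinM EFinB.
  rewrite integralZl//; last first.
    by apply: integrableB => //; apply: iut; exact: norm_step_le1.
  rewrite integralB_EFin//; last by apply: iut; exact: norm_step_le1.
  rewrite (integral_translation (step R s k) (f := EFin \o u)); last first.
    exact/measurable_EFinP.
  by rewrite subee ?mule0// integrable_fin_num.
have qK (t : R) k : `|q k t| <= K * \1_(`[- (B + 1), B + 1]%classic) t.
  rewrite /q normrM normfV indicE; case: (boolP (t \in _)) => [_|].
    rewrite mulr1 ler_pdivrMr ?normr_gt0 ?step_neq0//.
    have := uK (t + step R s k) t.
    by rewrite (_ : t + step R s k - t = step R s k)// addrC addKr.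
  rewrite notin_setE/= in_itv/= -ler_norml => /negP; rewrite -ltNge => Bt.
  have := norm_step_le1 R s k => h1.
  rewrite !uB; [by rewrite subr0 normr0 mul0r mulr0|lra|].
  by have := ler_normB (t + step R s k) (step R s k); rewrite addrK; lra.
have := @dominated_convergence _ _ _ leb setT measurableT
  (fun k t => (q k t)%:E) (EFin \o v)
  (fun t => (K * \1_(`[- (B + 1), B + 1]%classic) t)%:E).
case.
- by move=> k; exact/(measurable_EFinP _ (q k)).
- apply/measurable_EFinP.
  by apply: (measurable_fun_cvg (h := q)) => // t _; exact: uv.
- by apply: aeW => t _; apply: cvg_EFin; [near=> k|exact: uv].
- under eq_fun do rewrite EFinM.
  apply: integrableZl => //; exact: integrable_indic_itv.
- by apply: aeW => t k _; rewrite lee_fin; exact: qK.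
move=> iv _ H; split => //.
move: H; rewrite [X in X @ _ --> _](_ : _ = fun=> 0%E); last first.
  by apply/funext => k; exact: q0.
by move=> /(cvg_unique _ (cvg_cst _)) => /(_ (@ereal_hausdorff R)) <-.
Unshelve. all: by end_near.
Qed.

(* Split [f = w1 + w2] at the peak [t0], with [w1] supported on the right: then
   [|f (t + h) - f t|] is at most [w1 t - w1 (t + h) + w2 (t + h) - w2 t], plus
   [2 M] when [t] lies in [[t0 - h, t0]], and the first sum integrates to [0]. *)
Lemma unimodal_translation (f : R -> R) (M t0 h : R) :
  measurable_fun setT f -> (forall t, 0 <= f t <= M) ->
  (forall x y, x <= y -> y <= t0 -> f x <= f y) ->
  (forall x y, t0 <= x -> x <= y -> f y <= f x) ->
  (\int[leb]_t (f t)%:E < +oo)%E -> 0 < h ->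
  (\int[leb]_t (`|f (t + h) - f t|)%:E <= (2 * M * h)%:E)%E.
Proof.
move=> mf f0M fl fr fi h0.
have f0 t : 0 <= f t by have /andP[] := f0M t.
have fM t : f t <= M by have /andP[] := f0M t.
pose w1 t := if t0 <= t then f t else 0.
pose w2 t := if t0 <= t then 0 else f t.
have mle : measurable_fun [set: R] (fun t : R => t0 <= t) by exact: measurable_fun_ler.
have mw1 : measurable_fun setT w1 by exact: measurable_fun_ifT.
have mw2 : measurable_fun setT w2 by exact: measurable_fun_ifT.
have w10 t : 0 <= w1 t by rewrite /w1; case: ifP.
have w20 t : 0 <= w2 t by rewrite /w2; case: ifP.
have wf t : w1 t + w2 t = f t by rewrite /w1 /w2; case: ifP; rewrite ?addr0 ?add0r.
have mT (g : R -> R) : measurable_fun setT g -> measurable_fun [set: R] (fun t : R => g (t + h)).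
  by move=> mg; apply: measurableT_comp => //; exact: measurable_funD.
have mE (g : R -> R) : measurable_fun setT g -> measurable_fun setT (EFin \o g).
  by move=> mg; exact/measurable_EFinP.
pose I1 := (\int[leb]_t (w1 t)%:E)%E; pose I2 := (\int[leb]_t (w2 t)%:E)%E.
have I12 : (I1 + I2 = \int[leb]_t (f t)%:E)%E.
  rewrite -ge0_integralD//; [|by move=> t _; rewrite lee_fin|exact: mE|
    by move=> t _; rewrite lee_fin|exact: mE].
  by apply: eq_integral => t _; rewrite -EFinD wf.
have I12fin : (I1 + I2 \is a fin_num)%E.
  rewrite I12 ge0_fin_numE// integral_ge0// => t _; by rewrite lee_fin.
have mA : measurable_fun [set: R] (fun t : R => `|f (t + h) - f t|).
  apply: measurableT_comp => //; apply: measurable_funB => //; exact: mT.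
have IS : (\int[leb]_t (w1 (t + h) + w2 t)%:E = I1 + I2)%E.
  under eq_integral do rewrite EFinD.
  rewrite ge0_integralD//; [|by move=> t _; rewrite lee_fin|exact: (mE _ (mT _ mw1))|
    by move=> t _; rewrite lee_fin|exact: mE].
  by rewrite (integral_translation h (f := EFin \o w1))//; exact: mE.
have IS' : (\int[leb]_t (w1 t + w2 (t + h))%:E = I1 + I2)%E.
  under eq_integral do rewrite EFinD.
  rewrite ge0_integralD//; [|by move=> t _; rewrite lee_fin|exact: mE|
    by move=> t _; rewrite lee_fin|exact: (mE _ (mT _ mw2))].
  by rewrite (integral_translation h (f := EFin \o w2))//; exact: mE.
have IM : (\int[leb]_t (2 * M * \1_(`[(t0 - h)%R, t0]%classic) t)%:E = (2 * M * h)%:E)%E.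
  have M0 : 0 <= M by exact: le_trans (f0 0) (fM 0).
  under eq_integral do rewrite EFinM.
  rewrite ge0_integralZl//; last 2 first.
  - exact: (mE (\1_(`[(t0 - h)%R, t0]%classic))).
  - by rewrite lee_fin mulr_ge0.
  rewrite [X in (_ * X)%E](_ : _ = h%:E) ?EFinM//.
  rewrite integral_indic// setIT; apply: (etrans (lebesgue_measure_itv _)).
  rewrite /= lte_fin ifT; last by lra.
  by rewrite -EFinB; congr _%:E; ring.
rewrite -(leeD2rE _ _ I12fin) -{1}IS -IM -IS'.
rewrite -ge0_integralD//; [|exact: (mE _ mA)|by move=> t _; rewrite lee_fin addr_ge0|
  exact: (mE _ (measurable_funD (mT _ mw1) mw2))].
have M0 : 0 <= M by exact: le_trans (f0 0) (fM 0).
rewrite -ge0_integralD//; last 4 first.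
- by move=> t _; rewrite lee_fin !mulr_ge0.
- by apply: (mE (fun t => 2 * M * \1_(`[(t0 - h)%R, t0]%classic) t)); exact: measurable_funM.
- by move=> t _; rewrite lee_fin addr_ge0.
- exact: (mE _ (measurable_funD mw1 (mT _ mw2))).
apply: ge0_le_integral => //.
- by move=> t _; rewrite -EFinD lee_fin !addr_ge0.
- apply: (mE (fun t => `|f (t + h) - f t| + (w1 (t + h) + w2 t))).
  by apply: measurable_funD => //; apply: measurable_funD => //; exact: mT.
- apply: (mE (fun t => 2 * M * \1_(`[(t0 - h)%R, t0]%classic) t + (w1 t + w2 (t + h)))).
  apply: measurable_funD; first exact: measurable_funM.
  by apply: measurable_funD => //; exact: mT.
- move=> t _; rewrite -!EFinD lee_fin indicE mem_setE in_itv/= /w1 /w2.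
  have := fM t; have := fM (t + h); have := f0 t; have := f0 (t + h).
  have [t0t|tt0] := leP t0 t.
    have -> : t0 <= t + h by lra.
    have := fr t (t + h) t0t (ltac:(lra)) => ? ? ? ? ?.
    have b0 : 0 <= (((t0 - h <= t) && (t <= t0)) : nat)%:R :> R by [].
    rewrite ler0_norm; last by lra.
    have : 0 <= 2 * M * (((t0 - h <= t) && (t <= t0)) : nat)%:R by rewrite !mulr_ge0.
    lra.
  have [t0th|tht0] := leP t0 (t + h).
    have -> : t0 - h <= t by lra.
    rewrite (ltW tt0)/= mulr1 => ? ? ? ?.
    by case: (lerP (f t) (f (t + h))) => ?; lra.
  have -> : (t0 - h <= t) = false by apply/negbTE; rewrite -ltNge; lra.
  have := fl t (t + h) (ltac:(lra)) (ltW tht0) => ? ? ? ? ?.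
  by rewrite /= mulr0 ger0_norm; lra.
Qed.

End translation_quotients.

(** The domain is an arbitrary type: the weight of the restriction of [psi] to a line is then, by
    conversion, the restriction of the weight. *)
Definition weight (R : realType) (T : Type) (psi : T -> \bar R) (x : T) : R :=
  fine (expeR (- psi x)).

Section weight.
Context (R : realType) (T : Type).
Variable psi : T -> \bar R.
Hypothesis psiN : forall x, psi x != -oo%E.

Local Notation weight := (weight psi).
Local Notation fin x := (psi x \is a fin_num).
Local Notation r := (fine \o psi).

Lemma weightE x : expeR (- psi x) = (weight x)%:E.
Proof. by rewrite /weight; case: (psi x) (psiN x). Qed.

Lemma weight_ge0 x : 0 <= weight x.
Proof. by rewrite fine_ge0// expeR_ge0. Qed.

Lemma weight_fin x : fin x -> weight x = expR (- r x).
Proof. by move=> fx; rewrite /weight -(fineK fx). Qed.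

Lemma weight_nfin x : ~~ fin x -> weight x = 0.
Proof. by rewrite fin_numE psiN/= negbK => /eqP E; rewrite /weight E. Qed.

Lemma weight_gt0 x : (0 < weight x) = fin x.
Proof.
have [fx|fx] := boolP (fin x); first by rewrite weight_fin// expR_gt0.
by rewrite weight_nfin// ltxx.
Qed.

End weight.

Lemma measurable_EFin_comp (R : realType) (g : R -> R) :
  measurable_fun [set: R] g -> measurable_fun [set: R] (fun t => (g t)%:E).
Proof. by move=> mg; exact/(measurable_EFinP _ g). Qed.

Lemma integral_cst_itv (R : realType) (c a b : R) : 0 <= c -> a <= b ->
  (\int[@lebesgue_measure R]_t (c * \1_(`[a, b]%classic) t)%:E = (c * (b - a))%:E)%E.
Proof.
move=> c0 ab; under eq_integral do rewrite EFinM.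
rewrite ge0_integralZl//; last exact: measurable_EFin_comp.
rewrite EFinM; congr (_ * _)%E.
rewrite integral_indic// setIT; apply: (etrans (lebesgue_measure_itv _)).
rewrite /= lte_fin; case: ifPn => [_|]; first by rewrite -EFinB.
by rewrite -leNgt => ba; have -> : b - a = 0 by lra.
Qed.

Lemma expRN_ge_tangent (R : realType) (x y : R) :
  expR (- x) * (1 + (x - y)) <= expR (- y).
Proof.
have -> : expR (- y) = expR (- x + (x - y)) by congr expR; ring.
by rewrite expRD ler_pM2l ?expR_gt0// expR_ge1Dx.
Qed.

(** The tangent at [a] shows that the first-order remainder is nonnegative, and the tangent at [b]
    bounds it by the product on the right. *)
Lemma expRN_taylor1 (R : realType) (a b : R) :
  `|expR (- b) - expR (- a) + (b - a) * expR (- a)| <=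
  `|(b - a) * (expR (- b) - expR (- a))|.
Proof.
have := expRN_ge_tangent a b; have := expRN_ge_tangent b a => h1 h2.
rewrite ger0_norm; last by lra.
by rewrite -normrN; apply: le_trans (ler_norm _); lra.
Qed.

(** * Log-concave weights on the line: maximum and integrable derivative *)

Section log_concave.
Context (R : realType).
Local Notation leb := (@lebesgue_measure R).
Variable phi : R -> \bar R.
Hypothesis cphi : convex1 phi.
Hypothesis mphi : measurable_fun [set: R] phi.

Local Notation r := (fine \o phi).
Local Notation fin t := (phi t \is a fin_num).
Local Notation p := (fun s => side_deriv s phi).

Local Notation f := (weight phi).
Hypothesis cf : continuous f.
Hypothesis intf : (\int[leb]_t (f t)%:E < +oo)%E.

Let phiN : forall t, phi t != -oo%E. Proof. by case: cphi. Qed.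

(** The domain is the set where the continuous function [f] is positive, hence open. *)
Lemma near_weight_fin t : fin t -> \forall u \near t, fin u.
Proof.
rewrite -(weight_gt0 phiN) => /(cvgr_gt _ (@cf t)).
by apply: filterS => u; rewrite (weight_gt0 phiN).
Qed.

Let mf : measurable_fun [set: R] f.
Proof. exact: continuous_measurable_fun. Qed.

Lemma weight_quasiconcave a b c : a <= b -> b <= c -> f a <= f b \/ f c <= f b.
Proof.
move=> ab bc.
have [fa|fa] := boolP (fin a); last by left; rewrite (weight_nfin phiN fa) weight_ge0.
have [fc|fc] := boolP (fin c); last by right; rewrite (weight_nfin phiN fc) weight_ge0.
have [fb H] := convex1_chord cphi ab bc fa fc.
rewrite !weight_fin// !ler_expR !lerN2.
have [ba|ba] := leP (r b) (r a); first by left.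
right; rewrite leNgt; apply/negP => cb.
have : a < c.
  by rewrite ltNge; apply/negP => ca; move: ba; have -> : a = b by [lra]; rewrite ltxx.
move: H ba cb => /= H ba cb ac.
have h1 : 0 <= (c - b) * (fine (phi b) - fine (phi a)) by apply: mulr_ge0; lra.
have h2 : 0 <= (b - a) * (fine (phi b) - fine (phi c)) by apply: mulr_ge0; lra.
have [bc'|bc'] := ltP b c.
  have : 0 < (c - b) * (fine (phi b) - fine (phi a)) by apply: mulr_gt0; lra.
  lra.
have : 0 < (b - a) * (fine (phi b) - fine (phi c)) by apply: mulr_gt0; lra.
lra.
Qed.

Definition mass := fine (\int[leb]_t (f t)%:E)%E.

Let massE : (\int[leb]_t (f t)%:E = mass%:E)%E.
Proof.
rewrite /mass fineK// ge0_fin_numE// integral_ge0// => t _.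
by rewrite lee_fin weight_ge0.
Qed.

(** Quasi-concavity keeps [f] above [e] between the two points, so the mass is at least [e] times
    their distance. *)
Lemma weight_level_bounded e t1 t2 : 0 < e -> e <= f t1 -> e <= f t2 ->
  `|t2 - t1| <= mass / e.
Proof.
wlog t12 : t1 t2 / t1 <= t2.
  move=> H e0 h1 h2; have [|] := leP t1 t2; first by move=> ?; exact: H.
  by move=> ?; rewrite distrC; apply: H => //; exact: ltW.
move=> e0 e1 e2; rewrite ger0_norm ?subr_ge0// ler_pdivlMr// mulrC.
rewrite -lee_fin -massE -(integral_cst_itv (ltW e0) t12).
apply: ge0_le_integral => //.
- by move=> t _; rewrite lee_fin mulr_ge0// ltW.
- by apply: measurable_EFin_comp; exact: measurable_funM.
- exact: measurable_EFin_comp.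
- move=> t _; rewrite lee_fin indicE; case: (boolP (t \in _)) => [|_]; last first.
    by rewrite mulr0 weight_ge0.
  rewrite inE/= in_itv/= mulr1 => /andP[h1 h2].
  by have [|] := weight_quasiconcave h1 h2; [exact: le_trans|exact: le_trans].
Qed.

(** Outside the interval of radius [mass / f t1] around [t1] the values are at most [f t1], so the
    maximum over this compact interval is global. If [f] vanishes identically, any point serves. *)
Lemma weight_max : exists t0, forall t, f t <= f t0.
Proof.
have [[t1 t1f]|nf] := pselect (exists t, 0 < f t); last first.
  exists 0 => t; apply: (@le_trans _ _ 0); last exact: weight_ge0.
  by rewrite leNgt; apply/negP => t0; apply: nf; exists t.
pose D := mass / f t1.
have D0 : 0 <= D by have := weight_level_bounded t1f (lexx _) (lexx _); exact: le_trans.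
have [|t0 _ t0m] := @EVT_max R f (t1 - D) (t1 + D) _ (continuous_subspaceT cf).
  by lra.
exists t0 => t; have [tD|tD] := boolP (t \in `[t1 - D, t1 + D]%R).
  exact: t0m.
apply: (@le_trans _ _ (f t1)); last first.
  by apply: t0m; rewrite in_itv/=; apply/andP; split; lra.
rewrite leNgt; apply/negP => /ltW tf; move/negP: tD; apply.
have := weight_level_bounded t1f (lexx _) tf.
by rewrite in_itv/= ler_distl.
Qed.

Lemma weight_quotient_cvg s t : fin t ->
  (f (t + step R s k) - f t) / step R s k @[k --> \oo] --> - (p s t * f t).
Proof.
move=> ft; have nf := near_weight_fin ft.
have ct : (t + step R s k) @[k --> \oo] --> t.
  by rewrite -[X in _ --> X]addr0; apply: cvgD; [exact: cvg_cst|exact: cvg_step].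
have cfs : f (t + step R s k) @[k --> \oo] --> f t.
  exact: (cvg_comp _ _ ct (@cf t)).
have cq := @side_deriv_cvg _ phi cphi t nf s.
have nfk : \forall k \near \oo, fin (t + step R s k) by have := ct _ nf.
(* First-order error of the quotient: [expRN_taylor1] bounds it by a convergent quotient of [phi]
   times an increment of [f] that tends to 0. *)
pose E k := (f (t + step R s k) - f t) / step R s k + diff_quot s phi t k * f t.
have cE : E k @[k --> \oo] --> 0.
  apply: norm_cvg0.
  apply: (@squeeze_cvgr _ _ _ _ (fun=> 0)
    (fun k => `|diff_quot s phi t k * (f (t + step R s k) - f t)|)); last 2 first.
  - exact: cvg_cst.
  - rewrite -[X in _ --> X](@normr0 _ R); apply: cvg_norm.
    rewrite -[X in _ --> X](mulr0 (p s t)); apply: cvgM => //.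
    by rewrite -(subrr (f t)); apply: cvgB => //; exact: cvg_cst.
  near=> k; rewrite normr_ge0/=.
  have fk : fin (t + step R s k) by near: k.
  have h0 := step_neq0 R s k.
  rewrite -(ler_pM2r (_ : 0 < `|step R s k|)) ?normr_gt0// -!normrM /E /diff_quot.
  rewrite mulrDl mulfVK//.
  have -> : (fine (phi (t + step R s k)) - fine (phi t)) / step R s k * f t *
      step R s k = (r (t + step R s k) - r t) * f t by rewrite /=; field.
  have -> : (fine (phi (t + step R s k)) - fine (phi t)) / step R s k *
      (f (t + step R s k) - f t) * step R s k =
      (r (t + step R s k) - r t) * (f (t + step R s k) - f t).
    by rewrite /=; field.
  by rewrite (weight_fin ft) (weight_fin fk); exact: expRN_taylor1.
rewrite -[X in _ --> X]sub0r.
rewrite (_ : (fun _ => _) = fun k => E k - diff_quot s phi t k * f t); last first.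
  by apply/funext => k; rewrite /E addrK.
by apply: cvgB => //; apply: cvgM => //; exact: cvg_cst.
Unshelve. all: by end_near.
Qed.

Lemma measurable_side_deriv s : measurable_fun [set: R] (p s).
Proof.
apply: measurableT_comp => //; apply: measurable_fun_limn_esup => k.
have mr : measurable_fun [set: R] r by exact: measurableT_comp.
apply: measurable_EFin_comp; apply: measurable_funM => //.
apply: measurable_funB => //; apply: (measurableT_comp mr).
exact: measurable_funD.
Qed.

(** The function rises to its peak and then falls, so its variation is at most [2 M]. Fatou's lemma
    carries this bound from the quotients to their limit. *)
Lemma integral_side_deriv_le s M : (forall t, f t <= M) ->
  (\int[leb]_t (`|p s t * f t|)%:E <= (2 * M)%:E)%E.
Proof.
move=> fM; have [t0 ft0] := weight_max.
pose q k t := (f (t + step R s k) - f t) / step R s k.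
have mft h : measurable_fun [set: R] (fun t : R => f (t + h)).
  by apply: measurableT_comp => //; exact: measurable_funD.
have mq k : measurable_fun [set: R] (fun t => `|q k t|%:E).
  apply: measurable_EFin_comp; apply: measurableT_comp => //.
  by apply: measurable_funM => //; exact: measurable_funB.
have M0 : 0 <= M by apply: le_trans (fM 0); exact: weight_ge0.
have fl x y : x <= y -> y <= t0 -> f x <= f y.
  move=> xy yt; have [//|] := weight_quasiconcave xy yt.
  exact: le_trans (ft0 _).
have fr x y : t0 <= x -> x <= y -> f y <= f x.
  move=> tx xy; have [|//] := weight_quasiconcave tx xy.
  exact: le_trans (ft0 _).
have f0M t : 0 <= f t <= M by rewrite weight_ge0 fM.
have UT h : 0 < h -> (\int[leb]_t (`|f (t + h) - f t|)%:E <= (2 * M * h)%:E)%E.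
  by move=> h0; exact: (unimodal_translation mf f0M fl fr intf h0).
have qM k : (\int[leb]_t (`|q k t|)%:E <= (2 * M)%:E)%E.
  have k0 : 0 < k.+1%:R :> R by [].
  have mA h : measurable_fun [set: R] (fun t : R => `|f (t + h) - f t|%:E).
    apply: measurable_EFin_comp; apply: measurableT_comp => //.
    exact: measurable_funB.
  have -> : (\int[leb]_t (`|q k t|)%:E = k.+1%:R%:E *
      \int[leb]_t (`|f (t + step R s k) - f t|)%:E)%E.
    rewrite -ge0_integralZl//; last exact: mA.
    apply: eq_integral => t _; rewrite /q normrM normfV norm_step invrK.
    by rewrite mulrC EFinM.
  rewrite -lee_pdivlMl// -EFinM [leRHS](_ : _ = (2 * M * k.+1%:R^-1)%:E); last first.
    by rewrite mulrC.
  clear q mq; case: s; rewrite /step /= ?expr1 ?expr0 ?mul1r ?mulN1r; last first.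
    by apply: UT; rewrite invr_gt0.
  (* Left quotients: a translation turns the backward increment into a forward one. *)
  rewrite (_ : \int[_]_t _ = \int[leb]_t (`|f (t + k.+1%:R^-1) - f t|)%:E)%E.
    by apply: UT; rewrite invr_gt0.
  rewrite -[RHS](integral_translation (- k.+1%:R^-1)) ?mA//.
  by apply: eq_integral => t _; rewrite distrC subrK.
have := @fatou _ _ _ leb setT measurableT (fun k t => `|q k t|%:E) mq.
move=> /(_ (ltac:(by move=> *; rewrite lee_fin))) H.
apply: (@le_trans _ _ (limn_einf (fun k => \int[leb]_t `|q k t|%:E))%E); last first.
  rewrite limn_einf_lim; apply: lime_le; first exact: is_cvg_einfs.
  apply: nearW => k; apply: (@le_trans _ _ (\int[leb]_t `|q k t|%:E)%E) => //.
  by apply: ereal_inf_lbound; exists k => /=.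
apply: le_trans H; apply: ge0_le_integral => //.
- apply: measurable_EFin_comp; apply: measurableT_comp => //.
  by apply: measurable_funM => //; exact: measurable_side_deriv.
- rewrite /limn_einf; apply: measurableT_comp => //.
  apply: measurable_fun_limn_esup => k.
  by apply: measurableT_comp => //; exact: mq.
- move=> t _; have [ft|ft] := boolP (fin t).
    have c : `|q k t| @[k --> \oo] --> `|p s t * f t|.
      by rewrite -[X in _ --> X]normrN; apply: cvg_norm; exact: (@weight_quotient_cvg s t ft).
    have cE : `|q k t|%:E @[k --> \oo] --> `|p s t * f t|%:E.
      by apply: cvg_EFin => //; near=> k.
    by rewrite (cvg_limn_einf_sup cE).1.
  (* Off the domain [p s t] carries no meaning, but the factor [f t] is 0. *)
  rewrite (weight_nfin phiN)// mulr0 normr0 limn_einf_lim.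
  apply: lime_ge; first exact: is_cvg_einfs.
  by apply: nearW => k; apply: le_ereal_inf_tmp => _ [l _ <-]; rewrite lee_fin.
Unshelve. all: by end_near.
Qed.

End log_concave.

(** * Truncation and integration by parts on a line *)

Section truncation.
Context (R : realType).
Local Notation leb := (@lebesgue_measure R).
Variable phi : R -> \bar R.
Hypothesis cphi : convex1 phi.
Hypothesis mphi : measurable_fun [set: R] phi.

Local Notation r := (fine \o phi).
Local Notation fin t := (phi t \is a fin_num).
Local Notation p := (fun s => side_deriv s phi).
Local Notation f := (weight phi).
Let phiN : forall t, phi t != -oo%E. Proof. by case: cphi. Qed.
Hypothesis cf : continuous f.
Hypothesis intf : (\int[leb]_t (f t)%:E < +oo)%E.

(** Slopes of a convex function increase: two chord inequalities on each side compare [[s, t]] with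
    the outer intervals [[a', a]] and [[b, c']]. *)
Lemma convex1_slope_bounds a' a s t b c' : a' < a -> a <= s -> s <= t -> t <= b -> b < c' ->
  fin a' -> fin c' ->
  (r t - r s) * (c' - b) <= (t - s) * (r c' - r b) /\
  (t - s) * (r a - r a') <= (r t - r s) * (a - a').
Proof.
move=> a'a as' st tb bc fa fc.
have F x : a' <= x -> x <= c' -> fin x.
  by move=> ax xc; have [] := convex1_chord cphi ax xc fa fc.
have fs : fin s by apply: F; lra.
have ft : fin t by apply: F; lra.
have [||_ /= H1] := @convex1_chord _ phi cphi s t c' _ _ fs fc; [lra|lra|].
have [||_ /= H2] := @convex1_chord _ phi cphi t b c' _ _ ft fc; [lra|lra|].
have [||_ /= H3] := @convex1_chord _ phi cphi a' s t _ _ fa ft; [lra|lra|].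
have [||_ /= H4] := @convex1_chord _ phi cphi a' a s _ _ fa fs; [lra|lra|].
split => /=.
  rewrite -(ler_pM2r (_ : 0 < c' - t)); last by lra.
  have := ler_wpM2r (_ : 0 <= c' - b) H1; have := ler_wpM2r (_ : 0 <= t - s) H2.
  by move=> /(_ (ltac:(lra))) ? /(_ (ltac:(lra))) ?; lra.
rewrite -(ler_pM2r (_ : 0 < s - a')); last by lra.
have := ler_wpM2r (_ : 0 <= a - a') H3; have := ler_wpM2r (_ : 0 <= t - s) H4.
by move=> /(_ (ltac:(lra))) ? /(_ (ltac:(lra))) ?; lra.
Qed.

(** The set where [f >= e] is compact inside the open domain, so points [a - da] and [b + db] of the
    domain lie strictly beyond its ends. The slopes [S0] and [S1] of the two outer chords enclose
    those of [phi], and the exponential contributes at most the factor [f t0], the maximum of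
    [f]. *)
Lemma weight_lipschitz_level e : 0 < e -> exists2 K, 0 <= K &
  forall s t, e <= f s -> e <= f t -> `|f s - f t| <= K * `|s - t|.
Proof.
move=> e0; have [[t1 t1e]|nf] := pselect (exists t, e <= f t); last first.
  by exists 0 => // s t es; exfalso; apply: nf; exists s.
pose D := mass phi / e; pose J := [set t | e <= f t].
have J0 : J !=set0 by exists t1.
have cJ : compact J.
  apply: (@subclosed_compact _ _ `[t1 - D, t1 + D]%classic).
  - apply: (@preimage_closed _ _ f [set x | e <= x]); last exact: closed_ge.
    by move=> t _; exact: cf.
  - exact: segment_compact.
  - move=> t et; rewrite /= in_itv/= -ler_distl.
    exact: (weight_level_bounded cphi cf intf e0 t1e et).
have cid : {within J, continuous (idfun : R -> R)}.
  by apply: continuous_subspaceT => x; exact: cvg_id.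
have [b Jb bm] := compact_EVT_max J0 cJ cid.
have [a Ja am] := compact_EVT_min J0 cJ cid.
rewrite !inE /J/= in Ja Jb.
have fin_of t : e <= f t -> fin t.
  by move=> et; rewrite -(weight_gt0 phiN) (lt_le_trans e0).
have near_pt t : e <= f t -> exists2 d : R, 0 < d & forall u, `|u - t| <= d -> fin u.
  move=> et; have /nbhs_ballP[d /= d0 H] := near_weight_fin cphi cf (fin_of _ et).
  exists (d / 2); first by rewrite divr_gt0.
  move=> u ut; apply: H; rewrite /ball/= distrC.
  by apply: (le_lt_trans ut); rewrite gtr_pMr// invf_lt1// ltr1n.
have [db db0 Hb] := near_pt _ Jb; have [da da0 Ha] := near_pt _ Ja.
have fa' : fin (a - da) by apply: Ha; rewrite addrC addKr normrN ger0_norm// ltW.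
have fc' : fin (b + db) by apply: Hb; rewrite addrC addKr ger0_norm// ltW.
have [t0 ft0] := weight_max cphi cf intf.
pose S1 := (r (b + db) - r b) / db; pose S0 := (r a - r (a - da)) / da.
have f0 t : 0 <= f t := weight_ge0 phi t.
exists (f t0 * (`|S0| + `|S1|)); first by rewrite mulr_ge0// addr_ge0.
move=> s t.
wlog st : s t / s <= t.
  move=> H es et; have [st|/ltW ts] := leP s t; first exact: H.
  by rewrite distrC [in leRHS]distrC; exact: H.
move=> es et.
have as' : a <= s by apply: am; rewrite inE.
have tb : t <= b by apply: bm; rewrite inE.
have [||H1 H2] := @convex1_slope_bounds (a - da) a s t b (b + db) _ as' st tb _ fa' fc'.
- by lra.
- by lra.
have {}H1 : r t - r s <= (t - s) * S1.
  rewrite /S1 mulrA ler_pdivlMr//; move: H1; rewrite /=; lra.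
have {}H2 : (t - s) * S0 <= r t - r s.
  rewrite /S0 mulrA ler_pdivrMr//; move: H2; rewrite /=; lra.
have rst : `|r t - r s| <= (`|S0| + `|S1|) * `|s - t|.
  rewrite (distrC s) (ger0_norm (_ : 0 <= t - s)); last by lra.
  have ts0 : 0 <= t - s by lra.
  have h1 := ler_wpM2l ts0 (ler_norm S1).
  have h2 := ler_wpM2l ts0 (ler_norm (- S0)); rewrite normrN in h2.
  have h3 := mulr_ge0 ts0 (normr_ge0 S1).
  have h4 := mulr_ge0 ts0 (normr_ge0 S0).
  by rewrite ler_norml; apply/andP; split; lra.
rewrite -mulrA; apply: le_trans (ler_wpM2l (f0 t0) rst).
have fs := fin_of _ es; have ft := fin_of _ et.
have fE1 := weight_fin fs; have fE2 := weight_fin ft.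
have := expRN_ge_tangent (r s) (r t); have := expRN_ge_tangent (r t) (r s).
rewrite -fE1 -fE2 => h1 h2.
have h3 := ler_wpM2r (normr_ge0 (r t - r s)) (ft0 s).
have h4 := ler_wpM2r (normr_ge0 (r t - r s)) (ft0 t).
have h5 := ler_wpM2l (f0 s) (ler_norm (r t - r s)).
have h6 := ler_wpM2l (f0 t) (ler_norm (- (r t - r s))); rewrite normrN in h6.
by rewrite ler_norml; apply/andP; split; lra.
Qed.

Definition trunc (e t : R) : R := Num.max (f t - e) 0.

Lemma trunc_lipschitz e : 0 < e -> exists K B,
  (forall t t', `|trunc e t - trunc e t'| <= K * `|t - t'|) /\
  (forall t, B < `|t| -> trunc e t = 0).
Proof.
move=> e0; have [K K0 HK] := weight_lipschitz_level e0.
have [B HB] : exists B, forall t, B < `|t| -> f t < e.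
  have [[t1 t1e]|nf] := pselect (exists t, e <= f t); last first.
    by exists 0 => t _; rewrite ltNge; apply/negP => et; apply: nf; exists t.
  exists (mass phi / e + `|t1|) => t Bt; rewrite ltNge; apply/negP => et.
  have := weight_level_bounded cphi cf intf e0 t1e et.
  have := ler_normB (t - t1) (- t1); rewrite opprK subrK normrN; lra.
exists K, B; split; last first.
  by move=> t /HB fe; rewrite /trunc max_r//; lra.
move=> t t'; wlog tt' : t t' / t <= t'.
  move=> H; have [|/ltW] := leP t t'; first exact: H.
  by move=> ?; rewrite distrC [in leRHS]distrC; exact: H.
(* If just one of the two points is above the level, all the variation of [trunc e] takes place
   between it and a crossing point [c], where the Lipschitz bound for [f] applies. *)
have ivt : (f t < e <= f t') || (f t' < e <= f t) -> exists2 c, t <= c <= t' & f c = e.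
  move=> h; have [|c] := @IVT R f t t' e tt' (continuous_subspaceT cf).
    by move: h; rewrite ge_min le_max; case/orP => /andP[/ltW -> ->]; rewrite ?orbT.
  by rewrite in_itv/= => ? ?; exists c.
have K1 c : t <= c <= t' -> K * `|t - c| <= K * `|t - t'| /\ K * `|c - t'| <= K * `|t - t'|.
  by move=> /andP[? ?]; split; apply: ler_wpM2l => //;
    rewrite ler0_norm ?ler0_norm; lra.
rewrite /trunc.
have [et|te] := leP e (f t); have [et'|te'] := leP e (f t').
- rewrite !max_l; [|lra|lra].
  by have -> : f t - e - (f t' - e) = f t - f t' by [ring]; exact: HK.
- rewrite max_l; last lra.
  rewrite max_r; last lra.
  have [|c ct fc] := ivt; first by rewrite et te' orbT.
  rewrite subr0 -fc; have [+ _] := K1 _ ct; apply: le_trans.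
  by apply: HK => //; rewrite fc.
- rewrite max_r; last lra.
  rewrite max_l; last lra.
  have [|c ct fc] := ivt; first by rewrite et' te.
  rewrite sub0r opprB -fc; have [_] := K1 _ ct; apply: le_trans.
  by apply: HK => //; rewrite fc.
- by rewrite !max_r; [rewrite subrr normr0 mulr_ge0|lra|lra].
Qed.

(* The one-sided derivative of [trunc e]; on the level set [f = e] only the
   positive part of the increment survives. *)
Definition dtrunc s (e t : R) : R :=
  if e < f t then - (p s t * f t)
  else if f t < e then 0
  else (- (p s t * f t) + (-1) ^+ s * `|p s t * f t|) / 2.

Lemma trunc_quotient_cvg s e t : 0 < e ->
  (trunc e (t + step R s k) - trunc e t) / step R s k @[k --> \oo] --> dtrunc s e t.
Proof.
move=> e0.
have ct : (t + step R s k) @[k --> \oo] --> t.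
  by rewrite -[X in _ --> X]addr0; apply: cvgD; [exact: cvg_cst|exact: cvg_step].
have cfs : f (t + step R s k) @[k --> \oo] --> f t.
  exact: (cvg_comp _ _ ct (@cf t)).
rewrite /dtrunc; have [eft|fte|fte] := ltgtP e (f t).
- have ft : fin t by rewrite -(weight_gt0 phiN); lra.
  apply: cvg_trans (weight_quotient_cvg (s := s) cphi cf ft).
  apply: near_eq_cvg; near=> k.
  have : e < f (t + step R s k) by near: k; exact: (cvgr_gt _ cfs).
  by move=> ?; rewrite /trunc !max_l; [congr (_ / _); ring|lra|lra].
- apply: (@cvg_trans _ ((fun=> 0) @ \oo)); last exact: cvg_cst.
  apply: near_eq_cvg; near=> k.
  have : f (t + step R s k) < e by near: k; exact: (cvgr_lt _ cfs).
  by move=> ?; rewrite /trunc !max_r; [rewrite subrr mul0r|lra|lra].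
- have ft : fin t by rewrite -(weight_gt0 phiN); lra.
  have cq := weight_quotient_cvg (s := s) cphi cf ft.
  (* At the level itself the increment is a positive part, [(d + |d|) / 2]. Dividing [|d|] by a step
     of sign [(-1) ^+ s] puts this sign in front of the norm. *)
  rewrite (_ : (fun _ => _) = fun k =>
    ((f (t + step R s k) - f t) / step R s k +
     (-1) ^+ s * `|(f (t + step R s k) - f t) / step R s k|) / 2); last first.
    apply/funext => k; rewrite /trunc -fte subrr maxxx subr0.
    rewrite normrM normfV norm_step invrK /step invfM invr_sign invrK.
    set d := f _ - e; have [d0|d0] := leP d 0.
      by rewrite ler0_norm//; ring.
    by rewrite gtr0_norm//; field.
  apply: cvgM; last exact: cvg_cst.
  apply: cvgD => //; apply: cvgM; first exact: cvg_cst.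
  by rewrite -normrN; exact: cvg_norm.
Unshelve. all: by end_near.
Qed.

Lemma dtrunc_le s e t : `|dtrunc s e t| <= `|p s t * f t|.
Proof.
rewrite /dtrunc; case: ifPn => _; first by rewrite normrN.
case: ifPn => _; first by rewrite normr0.
rewrite normrM (ger0_norm (_ : 0 <= 2^-1)) ?invr_ge0//.
rewrite ler_pdivrMr// mulr_natr mulr2n (le_trans (ler_normD _ _))//.
by rewrite normrN lerD2l [leLHS]normrM normr_sign mul1r normr_id.
Qed.

(** The product [trunc e * g] is Lipschitz with bounded support, so the limit of its quotients
    integrates to 0. Then [e] tends to 0 under the integrable bound [C |p f| + G f], which does not
    depend on [e]. *)
Lemma log_concave_ibp s (g g' : R -> R) (C G : R) :
  (forall t, `|g t| <= C) -> (forall t t', `|g t - g t'| <= G * `|t - t'|) ->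
  (forall t, (g (t + step R s k) - g t) / step R s k @[k --> \oo] --> g' t) ->
  (\int[leb]_t (f t * g' t - p s t * f t * g t)%:E = 0)%E.
Proof.
move=> gC gG gg'.
have f0 t : 0 <= f t := weight_ge0 phi t.
have C0 : 0 <= C by exact: le_trans (gC 0).
have G0 : 0 <= G.
  by have := gG 0 1; rewrite sub0r normrN normr1 mulr1; exact: le_trans.
have g'G t : `|g' t| <= G.
  have := gg' t => /cvg_norm c; rewrite -(cvg_lim _ c)//.
  apply: limr_le; first exact: cvgP c.
  apply: nearW => k; rewrite normrM normfV ler_pdivrMr ?normr_gt0 ?step_neq0//.
  have := gG (t + step R s k) t.
  by rewrite (_ : t + step R s k - t = step R s k)// addrC addKr.
have mg : measurable_fun [set: R] g by exact: lipschitz_measurable gG.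
have mg' : measurable_fun [set: R] g'.
  pose h k t := (g (t + step R s k) - g t) / step R s k.
  apply: (measurable_fun_cvg (h := h)) => [k|t _]; last exact: gg'.
  apply: measurable_funM => //; apply: measurable_funB => //.
  by apply: measurableT_comp => //; exact: measurable_funD.
have mf : measurable_fun [set: R] f by exact: continuous_measurable_fun.
have mp := measurable_side_deriv mphi s.
have [t0 ft0] := weight_max cphi cf intf.
have ct (t : R) : (t + step R s k) @[k --> \oo] --> t.
  by rewrite -[X in _ --> X]addr0; apply: cvgD; [exact: cvg_cst|exact: cvg_step].
have E0 e : 0 < e -> leb.-integrable setT (fun t => (dtrunc s e t * g t + trunc e t * g' t)%:E) /\
    (\int[leb]_t (dtrunc s e t * g t + trunc e t * g' t)%:E = 0)%E.
  move=> e0; have [K [B [HK HB]]] := trunc_lipschitz e0.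
  apply: (@integral_cvg_quotient0 R (fun t => trunc e t * g t) _ (f t0 * G + C * K) B s).
  - move=> t t'.
    rewrite (_ : trunc e t * g t - _ = trunc e t * (g t - g t') + g t' * (trunc e t - trunc e t')); last by ring.
    rewrite (le_trans (ler_normD _ _))// !normrM mulrDl -!mulrA lerD// ler_pM//.
    by rewrite /trunc ger0_norm ?le_max ?lexx ?orbT// ge_max f0 andbT; have := ft0 t; lra.
  - by move=> t /HB ->; rewrite mul0r.
  - move=> t.
    rewrite (_ : (fun _ => _) = fun k =>
      (trunc e (t + step R s k) - trunc e t) / step R s k * g (t + step R s k) +
      trunc e t * ((g (t + step R s k) - g t) / step R s k)); last first.
      by apply/funext => k; ring.
    apply: cvgD; apply: cvgM; [exact: trunc_quotient_cvg| |exact: cvg_cst|exact: gg'].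
    apply: (cvg_comp _ _ (ct t)).
    apply/cvgrPdist_lt => eps eps0.
    have G1 : 0 < G + 1 by lra.
    have /cvgrPdist_lt/(_ (eps / (G + 1))) := @cvg_id _ (nbhs t).
    rewrite divr_gt0// => /(_ isT); apply: filterS => t' tt'.
    apply: (le_lt_trans (gG t t')); rewrite ltr_pdivlMr// in tt'.
    by apply: le_lt_trans tt'; rewrite mulrC ler_wpM2l//; lra.
pose e k : R := k.+1%:R^-1.
have e0 k : 0 < e k by rewrite invr_gt0.
have ip : leb.-integrable setT (fun t => (`|p s t * f t|)%:E).
  apply/integrableP; split.
    apply: measurable_EFin_comp; apply: measurableT_comp => //.
    exact: measurable_funM.
  under eq_integral do rewrite /= normr_id.
  apply: (@le_lt_trans _ _ (2 * f t0)%:E); last by rewrite ltry.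
  exact: integral_side_deriv_le.
have iff : leb.-integrable setT (fun t => (f t)%:E).
  apply/integrableP; split; first exact: measurable_EFin_comp.
  by under eq_integral do rewrite /= ger0_norm//.
have := @dominated_convergence _ _ _ leb setT measurableT
  (fun k t => (dtrunc s (e k) t * g t + trunc (e k) t * g' t)%:E)
  (fun t => (f t * g' t - p s t * f t * g t)%:E)
  (fun t => C%:E * (`|p s t * f t|)%:E + G%:E * (f t)%:E)%E.
case.
- by move=> k; have [/measurable_int] := E0 _ (e0 k).
- apply: measurable_EFin_comp; apply: measurable_funB; apply: measurable_funM => //.
  exact: measurable_funM.
- apply: aeW => t _; apply: cvg_EFin; first by near=> k.
  have ce : e k @[k --> \oo] --> 0 by exact: cvg_harmonic.
  have [ft|ft] := ltP 0 (f t); last first.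
    have ft' : f t = 0 by have := f0 t; lra.
    rewrite ft' mul0r mulr0 mul0r subr0.
    apply: (@cvg_trans _ ((fun=> 0) @ \oo)); last exact: cvg_cst.
    apply: near_eq_cvg; near=> k.
    rewrite /= /dtrunc /trunc ft' (lt_gtF (e0 k)) e0 mul0r add0r.
    by rewrite max_r ?mul0r// sub0r oppr_le0 ltW.
  (* Once [e k < f t] the first branch of [dtrunc] applies; its value on the level set leaves no
     trace in the limit. *)
  apply: (@cvg_trans _ ((fun k => - (p s t * f t) * g t + (f t - e k) * g' t) @ \oo)).
    apply: near_eq_cvg; near=> k.
    have ek : e k < f t by near: k; exact: (cvgr_lt _ ce).
    by rewrite /= /dtrunc ek /trunc max_l// subr_ge0 ltW.
  rewrite addrC mulNr; apply: cvgD; first exact: cvg_cst.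
  apply: cvgM; last exact: cvg_cst.
  by rewrite -[X in _ --> X]subr0; apply: cvgB => //; exact: cvg_cst.
- by apply: integrableD => //; exact: integrableZl.
- apply: aeW => t k _; rewrite abse_EFin -!EFinM -EFinD lee_fin.
  rewrite (le_trans (ler_normD _ _))// !normrM.
  apply: lerD; rewrite mulrC; apply: ler_pM => //.
    by have := dtrunc_le s (e k) t; rewrite normrM.
  rewrite /trunc ger0_norm ?le_max ?lexx ?orbT// ge_max f0 andbT.
  by have := e0 k; lra.
move=> _ _; rewrite [X in X @ _ --> _](_ : _ = fun=> 0%E); last first.
  by apply/funext => k; have [_ +] := E0 _ (e0 k).
by move=> /(cvg_unique _ (cvg_cst _)) => /(_ (@ereal_hausdorff R)) <-.
Unshelve. all: by end_near.
Qed.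

End truncation.

(** * Partial derivatives and gradient of a convex function *)

(** The chords from [t] to [t - h] and to [t + h] lie above the function. One [h = 1 / (k + 1)] for
    which both chord slopes are within [e] of [d] therefore gives the bound for all [|u| <= h]. *)
Lemma convex1_le_tangent (R : realType) (phi : R -> \bar R) (t d : R) :
  convex1 phi -> (\forall u \near t, phi u \is a fin_num) ->
  side_deriv true phi t = d -> side_deriv false phi t = d ->
  forall e : R, 0 < e ->
  \forall u \near 0, fine (phi (t + u)) <= fine (phi t) + d * u + e * `|u|.
Proof.
move=> cphi ft dt df e e0.
have ct s : (t + step R s k) @[k --> \oo] --> t.
  by rewrite -[X in _ --> X]addr0; apply: cvgD; [exact: cvg_cst|exact: cvg_step].
have c1 := @side_deriv_cvg _ phi cphi t ft true.
have c2 := @side_deriv_cvg _ phi cphi t ft false.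
rewrite dt in c1; rewrite df in c2.
have [k [[fm fp] [/= qm qp]]] : exists k,
    ((phi (t + step R true k) \is a fin_num) /\ (phi (t + step R false k) \is a fin_num)) /\
    (`|d - diff_quot true phi t k| <= e /\ `|d - diff_quot false phi t k| <= e).
  have H : \forall k \near \oo,
    ((phi (t + step R true k) \is a fin_num) /\ (phi (t + step R false k) \is a fin_num)) /\
    (`|d - diff_quot true phi t k| <= e /\ `|d - diff_quot false phi t k| <= e).
    near=> k; split; split.
    - by near: k; exact: (ct true _ ft).
    - by near: k; exact: (ct false _ ft).
    - by near: k; move/cvgrPdist_le : c1; exact.
    - by near: k; move/cvgrPdist_le : c2; exact.
  by have [k _ /(_ k (leqnn k))] := H; exists k.
have ft0 := nbhs_singleton ft.
move: fm fp qm qp; rewrite /diff_quot /step !expr1 !expr0 mul1r mulN1r.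
set h := k.+1%:R^-1; have h0 : 0 < h :> R by rewrite invr_gt0.
move=> fm fp /ler_normlP[qm1 qm2] /ler_normlP[qp1 qp2].
rewrite invrN mulrN in qm1 qm2.
have hm : (fine (phi (t - h)) - fine (phi t)) = - (- ((fine (phi (t - h)) - fine (phi t)) / h)) * h.
  by field; rewrite gt_eqF.
have hp : (fine (phi (t + h)) - fine (phi t)) = ((fine (phi (t + h)) - fine (phi t)) / h) * h.
  by field; rewrite gt_eqF.
move: qm1 qm2 qp1 qp2 hm hp; set qm := - (_ / _); set qp := _ / h => qm1 qm2 qp1 qp2 hm hp.
near=> u.
have uh : `|u| <= h.
  by near: u; apply/nbhs_ballP; exists h => //= u; rewrite /ball/= sub0r normrN => /ltW.
have [u0|u0] := leP 0 u.
  rewrite ger0_norm// in uh *.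
  have [||_ /= H] := @convex1_chord _ phi cphi t (t + u) (t + h) _ _ ft0 fp; [lra|lra|].
  have h1 : u * (qp - d) <= u * e by apply: ler_wpM2l => //; lra.
  rewrite -(ler_pM2r h0).
  have := ler_wpM2r (ltW h0) h1; move: H hp; nra.
rewrite ltr0_norm// in uh *.
have [||_ /= H] := @convex1_chord _ phi cphi (t - h) (t + u) t _ _ fm ft0; [lra|lra|].
have h1 : - u * (d - qm) <= - u * e by apply: ler_wpM2l; lra.
rewrite -(ler_pM2r h0).
have := ler_wpM2r (ltW h0) h1; move: H hm; nra.
Unshelve. all: by end_near.
Qed.

(** * Differentiability from one-sided partial derivatives *)

Section convex_rV.
Context (R : realType) (n : nat).
Variable psi : 'rV[R]_n -> \bar R.
Hypothesis cpsi : convex_efun psi.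

Local Notation r := (fine \o psi).
Local Notation fin x := (psi x \is a fin_num).
Local Notation e_ i := (delta_mx ord0 i : 'rV[R]_n).

Definition line (i : 'I_n) (x : 'rV[R]_n) (t : R) : \bar R := psi (x + t *: e_ i).

Lemma convex1_line i x : convex1 (line i x).
Proof.
have [psiN cvx] := cpsi; split => [t|a b t t01]; first exact: psiN.
rewrite /line; have := cvx (x + a *: e_ i) (x + b *: e_ i) t t01.
suff -> : t *: (x + a *: e_ i) + (1 - t) *: (x + b *: e_ i) = x + (t * a + (1 - t) * b) *: e_ i by [].
by apply/rowP => j; rewrite !mxE; ring.
Qed.

Definition partial s i x := side_deriv s (line i x) 0.

Lemma near_line i (x : 'rV[R]_n) : (\forall y \near x, fin y) -> \forall t \near 0, line i x t \is a fin_num.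
Proof.
move=> fx; have c : (x + t *: e_ i) @[t --> (0 : R)] --> x.
  rewrite -[X in _ --> X]addr0 -(scale0r (e_ i)).
  by apply: cvgD; [exact: cvg_cst|exact: scalel_continuous].
exact: (c _ fx).
Qed.

(** Jensen's inequality with equal weights. Indexing by [nat] lets the induction split off the last
    point, which has weight [1 / (k + 2)]. *)
Lemma convex_efun_mean (y : nat -> 'rV[R]_n) k : (forall j, (j <= k)%N -> fin (y j)) ->
  fin (k.+1%:R^-1 *: \sum_(j < k.+1) y j) /\
  k.+1%:R * r (k.+1%:R^-1 *: \sum_(j < k.+1) y j) <= \sum_(j < k.+1) r (y j).
Proof.
have [psiN cvx] := cpsi.
elim: k => [|k IH] fy.
  rewrite !big_ord1 invr1 scale1r mul1r; split => //; exact: fy.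
have [fm Hm] := IH (fun j jk => fy j (leqW jk)).
set m := k.+1%:R^-1 *: _ in fm Hm.
have k0 : 0 < k.+1%:R :> R by [].
have k1 : k.+2%:R = k.+1%:R + 1 :> R by rewrite -natr1.
pose t : R := k.+1%:R / k.+2%:R.
have t01 : 0 <= t <= 1.
  by rewrite divr_ge0//= ler_pdivrMr ?ltr0n// mul1r ler_nat.
have tE : 1 - t = k.+2%:R^-1 by rewrite /t k1; field; rewrite gt_eqF//; lra.
have E : k.+2%:R^-1 *: \sum_(j < k.+2) y j = t *: m + (1 - t) *: y k.+1.
  rewrite big_ord_recr /= scalerDr tE; congr (_ + _).
  rewrite /m scalerA; congr (_ *: _).
  by rewrite /t mulrAC mulfV ?mul1r// gt_eqF.
rewrite E; have := cvx m (y k.+1) t t01; have fyk := fy k.+1 (leqnn _).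
rewrite -(fineK fm) -(fineK fyk) -!EFinM -EFinD => H.
have fz : fin (t *: m + (1 - t) *: y k.+1).
  by rewrite fin_numE psiN/= -ltey (le_lt_trans H)// ltry.
split => //; move: H; rewrite -(fineK fz) lee_fin => H.
rewrite big_ord_recr/=; apply: le_trans (lerD Hm (lexx _)).
rewrite -ler_pdivlMl ?ltr0n//; apply: (le_trans H); rewrite tE.
by rewrite mulrDr /t /= le_eqVlt; apply/orP; left; apply/eqP; ring.
Qed.

Lemma edifferentiable_partial x s i : edifferentiable psi x ->
  partial s i x = 'D_(e_ i) r x.
Proof.
move=> [fx dx].
have := diff_derivable (v := e_ i) dx; rewrite /derivable => dvx.
have c0 := side_deriv_cvg (convex1_line i x) (near_line i fx) (s := s).
have cs : step R s @ \oo --> (0 : R)^'.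
  move=> A [e /= e0 Ae].
  have /cvgrPdist_lt/(_ _ e0) := @cvg_step R s; apply: filterS => k ke.
  by apply: Ae => //; exact: step_neq0.
have := cvg_comp _ _ cs dvx.
rewrite (_ : _ \o _ = diff_quot s (line i x) 0); last first.
  apply/funext => k; rewrite /diff_quot /line /= add0r scale0r addr0.
  by rewrite (addrC x) -[LHS]/(_ * _) mulrC.
by move=> c1; exact: (cvg_unique _ c0 c1).
Qed.

Lemma cvg_coord_rV i : (h : 'rV[R]_n) ord0 i @[h --> (0 : 'rV[R]_n)] --> (0 : R).
Proof.
rewrite -[X in _ --> X](_ : (0 : 'rV[R]_n) ord0 i = 0); last by rewrite mxE.
exact: coord_continuous.
Qed.

(** The point [x + h] is the mean of the [n] points [x + n h_i e_i], so Jensen's inequality reduces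
    the bound to the coordinate axes. The tolerance [e / n] compensates the dilation by [n]. *)
Lemma convex_efun_le_tangent (x : 'rV[R]_n) : (0 < n)%N -> (\forall y \near x, fin y) ->
  (forall i, partial true i x = partial false i x) ->
  forall e : R, 0 < e -> \forall h \near (0 : 'rV[R]_n),
  fin (x + h) /\
  r (x + h) <= r x + \sum_i h ord0 i * partial false i x + e * `|h|.
Proof.
move=> n0 fx pp e e0.
have n0' : 0 < n%:R :> R by rewrite ltr0n.
have en0 : 0 < e / n%:R by rewrite divr_gt0.
pose T i (h : 'rV[R]_n) : Prop := line i x (n%:R * h ord0 i) \is a fin_num /\
    fine (line i x (n%:R * h ord0 i)) <=
    r x + partial false i x * (n%:R * h ord0 i) + e / n%:R * `|n%:R * h ord0 i|.
have cT i : \forall h \near (0 : 'rV[R]_n), T i h.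
  have cn : (n%:R * (h : 'rV[R]_n) ord0 i) @[h --> (0 : 'rV[R]_n)] --> (0 : R).
    rewrite -[X in _ --> X](mulr0 n%:R).
    exact: (cvg_comp _ _ (@cvg_coord_rV i) (@mulrl_continuous R n%:R 0)).
  have H1 := cn _ (near_line i fx).
  have H2 := cn _ (convex1_le_tangent (convex1_line i x) (near_line i fx) (pp i) erefl en0).
  near=> h; split; first by near: h; exact: H1.
  have : fine (line i x (0 + n%:R * h ord0 i)) <=
    fine (line i x 0) + partial false i x * (n%:R * h ord0 i) + e / n%:R * `|n%:R * h ord0 i|.
    by near: h; exact: H2.
  by rewrite add0r {2}/line scale0r addr0.
have cTall : \forall h \near (0 : 'rV[R]_n), forall i, T i h.
  exact: (filter_forall (nbhs_filter (0 : 'rV[R]_n))) cT.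
near=> h.
have {}H : forall i, T i h.
  by near: h.
pose y (j : nat) : 'rV[R]_n := if insub j is Some i then x + (n%:R * h ord0 i) *: e_ i else x.
have nE : n.-1.+1 = n by rewrite prednK.
have yE (i : 'I_n) : y i = x + (n%:R * h ord0 i) *: e_ i by rewrite /y valK.
have fy j : (j <= n.-1)%N -> fin (y j).
  move=> jn; have jn' : (j < n)%N by rewrite -nE ltnS.
  by rewrite (yE (Ordinal jn')); have [] := H (Ordinal jn').
have [fm Hm] := convex_efun_mean fy.
have sumE : \sum_(j < n.-1.+1) y j = n%:R *: (x + h).
  rewrite nE; under eq_bigr do rewrite yE.
  rewrite big_split/= sumr_const card_ord -scaler_nat scalerDr; congr (_ + _).
  rewrite [h in RHS](row_sum_delta h) scaler_sumr.
  by apply: eq_bigr => i _; rewrite scalerA.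
have mE : n.-1.+1%:R^-1 *: \sum_(j < n.-1.+1) y j = x + h.
  by rewrite sumE nE scalerA mulVf ?scale1r// gt_eqF.
rewrite mE in fm Hm; split => //.
rewrite -(ler_pM2l n0'); rewrite [X in X%:R * _ <= _]nE in Hm.
apply: (le_trans Hm).
rewrite nE; under eq_bigr do rewrite yE.
apply: (@le_trans _ _ (\sum_(i < n) (r x + n%:R * (h ord0 i * partial false i x) + e * `|h|))).
  apply: ler_sum => i _; have [_ Hi] := H i; apply: (le_trans Hi).
  apply: lerD; first by rewrite lerD2l le_eqVlt; apply/orP; left; apply/eqP; ring.
  rewrite normrM normr_nat mulrA divfK ?gt_eqF// ler_pM2l//.
  exact: ler_coord_norm.
rewrite !big_split/= !sumr_const card_ord -mulr_sumr.
rewrite -[fine _ *+ n]mulr_natl -[(_ * _) *+ n]mulr_natl.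
by rewrite le_eqVlt; apply/orP; left; apply/eqP; ring.
Unshelve. all: by end_near.
Qed.

(** Convexity turns the upper tangent bound into a lower one: the bound at [- h] and
    [2 psi x <= psi (x + h) + psi (x - h)] bound [psi (x + h)] from below. *)
Lemma edifferentiable_of_partial (x : 'rV[R]_n) : (0 < n)%N -> (\forall y \near x, fin y) ->
  (forall i, partial true i x = partial false i x) -> edifferentiable psi x.
Proof.
move=> n0 fx pp; split => //.
pose df (h : 'rV[R]_n) : R := \sum_i h ord0 i * partial false i x.
have dlin : linear df.
  move=> a u v; rewrite /df scaler_sumr -big_split/=; apply: eq_bigr => i _.
  by rewrite !mxE mulrDl -mulrA.
pose L : {linear 'rV[R]_n -> R} := HB.pack df (GRing.isLinear.Build _ _ _ _ df dlin).
have cL : continuous df.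
  apply: continuous_big => [|i _ h]; first exact: add_continuous.
  exact: (cvg_comp _ _ (@coord_continuous R 1 n ord0 i h)
    (@mulrr_continuous R (partial false i x) (h ord0 i))).
have fx0 := nbhs_singleton fx.
have HL (e : R) : 0 < e -> \forall h \near (0 : 'rV[R]_n),
    `|r (h + x) - (r x + df h)| <= e * `|h|.
  move=> e0.
  have H := convex_efun_le_tangent n0 fx pp e0.
  have HN : \forall h \near (0 : 'rV[R]_n), fin (x - h) /\
     r (x - h) <= r x + \sum_i (- h) ord0 i * partial false i x + e * `|- h|.
    have cN : - (h : 'rV[R]_n) @[h --> (0 : 'rV[R]_n)] --> (0 : 'rV[R]_n).
      by rewrite -[X in _ --> X]oppr0; exact: opp_continuous.
    exact: (cN _ H).
  near=> h.
  have [f1 H1] : fin (x + h) /\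
    r (x + h) <= r x + \sum_i h ord0 i * partial false i x + e * `|h| by near: h.
  have [f2 H2] : fin (x - h) /\
     r (x - h) <= r x + \sum_i (- h) ord0 i * partial false i x + e * `|- h| by near: h.
  have sN : \sum_i (- h) ord0 i * partial false i x = - df h.
    by rewrite /df -sumrN; apply: eq_bigr => i _; rewrite mxE mulNr.
  rewrite sN normrN in H2.
  have [_ /(_ (x + h) (x - h) 2^-1)] := cpsi.
  have -> : 2^-1 *: (x + h) + (1 - 2^-1) *: (x - h) = x.
    by apply/rowP => j; rewrite !mxE; field.
  have h2 : 0 <= (2^-1 : R) <= 1 by rewrite invr_ge0 ler0n invf_le1 ?ltr0n// ler1n.
  move=> /(_ h2); rewrite -(fineK f1) -(fineK f2) -(fineK fx0) -!EFinM -EFinD lee_fin => H3.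
  rewrite (addrC h) /=; rewrite /= -/(df h) in H1 H2 H3.
  by rewrite ler_norml; apply/andP; split; lra.
have dE : 'd r x = df :> (_ -> _).
  by apply: (diff_unique (df := L)) => //; apply/eqaddoP => e e0; exact: HL.
apply/diff_locallyP; rewrite dE; split; first exact: cL.
by apply/eqaddoP => e e0; exact: HL.
Unshelve. all: by end_near.
Qed.

(** An open condition and equalities of measurable functions: this makes the set of
    differentiability measurable, and later turns the almost everywhere equality of one-sided
    partials into differentiability. *)
Lemma edifferentiableP (x : 'rV[R]_n) : (0 < n)%N -> edifferentiable psi x <->
  (\forall y \near x, fin y) /\ forall i, partial true i x = partial false i x.
Proof.
move=> n0; split; last by case; exact: edifferentiable_of_partial.
move=> dx; split; first by case: dx.
by move=> i; rewrite !edifferentiable_partial.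
Qed.

Hypothesis lpsi : lower_semicontinuous psi.

Lemma measurable_lsc : measurable_fun [set: 'rV[R]_n] psi.
Proof.
apply: (measurability _ (ErealGenOInfty.measurableE R)) => /= _ [_ [a ->]] <-.
apply: measurableI => //; apply: open_measurable_rV.
by rewrite preimage_itvoy; move/lower_semicontinuousP : lpsi; exact.
Qed.

Lemma measurable_partial s i : measurable_fun [set: 'rV[R]_n] (partial s i).
Proof.
apply: measurableT_comp => //; apply: measurable_fun_limn_esup => k.
apply/measurable_EFinP; apply: measurable_funM => //.
have mline (t : R) : measurable_fun [set: 'rV[R]_n] (fun x => fine (line i x t)).
  apply: measurableT_comp => //; apply: (measurableT_comp measurable_lsc).
  apply: measurable_fun_rowP => j; under eq_fun do rewrite !mxE.
  by apply: measurable_funD => //; exact: measurable_coord.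
by apply: measurable_funB.
Qed.

Lemma measurable_edifferentiable : (0 < n)%N -> measurable [set x | edifferentiable psi x].
Proof.
move=> n0; rewrite (_ : [set x | _] = [set x | \forall y \near x, fin y] `&`
   \bigcap_(i in [set: 'I_n]) [set x | partial true i x = partial false i x]); last first.
  apply/seteqP; split => x /=.
    by move=> /(edifferentiableP _ n0)[? H]; split => // i _; exact: H.
  by move=> [? H]; apply/(edifferentiableP _ n0); split => // i; exact: H.
apply: measurableI.
  by apply: open_measurable_rV; exact: open_interior.
apply: fin_bigcap_measurable => // i _.
have := measurable_fun_eqr (measurable_partial true i) (measurable_partial false i).
move=> /(_ measurableT [set true] I); rewrite setTI.
by congr measurable; apply/seteqP; split => x /= /eqP.
Qed.

Lemma measurable_gradient : (0 < n)%N -> measurable_fun [set: 'rV[R]_n] (gradient psi).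
Proof.
move=> n0; apply: measurable_fun_rowP => i.
rewrite (_ : (fun x => _) = fun x =>
   if x \in [set x | edifferentiable psi x] then partial false i x else 0); last first.
  apply/funext => x; rewrite /gradient; case: pselect => dx.
    by rewrite mem_set// mxE edifferentiable_partial.
  by rewrite memNset// mxE.
apply: measurable_fun_ifT => //.
  apply: (measurable_fun_bool true); rewrite setTI.
  rewrite (_ : _ @^-1` _ = [set x | edifferentiable psi x]).
    exact: measurable_edifferentiable.
  by apply/seteqP; split => x /=; [move/set_mem|move/mem_set].
exact: measurable_partial.
Qed.

End convex_rV.

(** * Integrals against the weight [exp (- psi)] *)

Section density.
Context d (T : measurableType d) (R : realType).
Variables (mu nu : {measure set T -> \bar R}) (w : T -> R).
Hypothesis mw : measurable_fun setT w.
Hypothesis w0 : forall x, 0 <= w x.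
Hypothesis nuE : forall A, measurable A -> (nu A = \int[mu]_(x in A) (w x)%:E)%E.
Local Open Scope ereal_scope.

Import HBNNSimple.

Lemma ge0_integral_density (h : T -> \bar R) : measurable_fun setT h ->
  (forall x, 0 <= h x) -> \int[nu]_x h x = \int[mu]_x (h x * (w x)%:E).
Proof.
move=> mh h0.
have mwE : measurable_fun setT (fun x => (w x)%:E) by exact/measurable_EFinP.
have indicE A : measurable A -> \int[nu]_x (\1_A x)%:E = \int[mu]_x ((\1_A x)%:E * (w x)%:E).
  move=> mA; rewrite integral_indic// setIT nuE// integral_mkcond.
  apply: eq_integral => x _; rewrite patchE indicE.
  by case: (x \in A); rewrite ?mul1e ?mul0e.
pose h_ := nnsfun_approx measurableT mh.
have mh_ n : measurable_fun setT (fun x => (h_ n x)%:E).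
  by apply/measurable_EFinP.
have simple n : \int[nu]_x (h_ n x)%:E = \int[mu]_x ((h_ n x)%:E * (w x)%:E).
  under eq_integral do rewrite fimfunE -fsumEFin//.
  rewrite ge0_integral_fsum//; last 2 first.
  - move=> r; apply/measurable_EFinP; exact: measurable_funM.
  - by move=> r x _; rewrite nnfun_muleindic_ge0.
  have hE x : (h_ n x)%:E * (w x)%:E = \sum_(r \in range (h_ n))
      ((r * \1_(h_ n @^-1` [set r]) x)%:E * (w x)%:E).
    rewrite {1}fimfunE -fsumEFin// ge0_mule_fsuml// => r.
    exact: nnfun_muleindic_ge0.
  under [RHS]eq_integral do rewrite hE.
  rewrite ge0_integral_fsum//; last 2 first.
  - move=> r; apply: emeasurable_funM => //.
    by apply/measurable_EFinP; exact: measurable_funM.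
  - by move=> r x _; rewrite mule_ge0 ?nnfun_muleindic_ge0 ?lee_fin.
  apply: eq_fsbigr => r; rewrite inE => -[y _ hy].
  have r0 : (0 <= r)%R by rewrite -hy.
  have mr : measurable (h_ n @^-1` [set r]) by [].
  under eq_integral do rewrite EFinM.
  rewrite ge0_integralZl//; last exact/measurable_EFinP.
  rewrite (indicE _ mr) -ge0_integralZl//.
  - by apply: eq_integral => x _; rewrite muleA.
  - apply: emeasurable_funM => //; exact/measurable_EFinP.
  - by move=> x _; rewrite mule_ge0 ?lee_fin.
transitivity (limn (fun n => \int[nu]_x (h_ n x)%:E)).
  rewrite -monotone_convergence//.
  - apply: eq_integral => x _; apply/esym/cvg_lim => //.
    by apply: cvg_nnsfun_approx => // *; exact: h0.
  - by move=> n x _; rewrite lee_fin.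
  - by move=> x _ a b ab; rewrite lee_fin; exact/lefP/nd_nnsfun_approx.
under eq_fun do rewrite simple.
rewrite -monotone_convergence//.
- apply: eq_integral => x _; apply/cvg_lim => //; apply: cvgeZr => //.
  by apply: cvg_nnsfun_approx => // *; exact: h0.
- by move=> n; exact: emeasurable_funM.
- by move=> n x _; rewrite mule_ge0// lee_fin.
- move=> x _ a b ab; rewrite lee_wpmul2r ?lee_fin//.
  exact/lefP/nd_nnsfun_approx.
Qed.

Lemma integral_density (h : T -> R) : measurable_fun setT h ->
  \int[nu]_x (h x)%:E = \int[mu]_x (h x * w x)%:E.
Proof.
move=> mh; have mhE : measurable_fun setT (EFin \o h) by exact/measurable_EFinP.
rewrite integralE [RHS]integralE; congr (_ - _).
- rewrite ge0_integral_density//; last exact: measurable_funepos.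
  apply: eq_integral => x _; rewrite !funeposE/= -!EFin_max -EFinM.
  by rewrite maxr_pMl// mul0r.
- rewrite ge0_integral_density//; last exact: measurable_funeneg.
  apply: eq_integral => x _; rewrite !funenegE/= -!EFin_max -EFinM.
  by rewrite maxr_pMl// mul0r mulNr.
Qed.

End density.

Section continuous_weight.
Context (R : realType) (T : topologicalType).
Variable psi : T -> \bar R.
Hypothesis psiN : forall x, psi x != -oo%E.

Local Notation weight := (weight psi).
Local Notation fin x := (psi x \is a fin_num).
Local Notation r := (fine \o psi).

Lemma continuous_weight (x : T) :
  {for x, continuous psi} -> {for x, continuous weight}.
Proof.
move=> cx; have [fx|fx] := boolP (fin x).
  have cx' : psi y @[y --> x] --> (r x)%:E by rewrite /= fineK.
  have [nf cr] := (fine_cvgP _ _).1 cx'.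
  change (weight y @[y --> x] --> weight x); rewrite [weight x]weight_fin//.
  apply: (@cvg_trans _ ((fun y => expR (- r y)) @ x)).
    apply: near_eq_cvg; near=> y; rewrite /= weight_fin//.
    by near: y; exact: nf.
  apply: (@cvg_comp _ _ _ (fun y => - r y) expR _ (nbhs (- r x))).
    exact: cvgN.
  exact: continuous_expR.
change (weight y @[y --> x] --> weight x); rewrite [weight x](weight_nfin psiN)//.
have E : psi x = +oo%E by move: fx; rewrite fin_numE psiN/= negbK => /eqP.
have cy : psi y @[y --> x] --> +oo%E by rewrite -E.
apply/cvgrPdist_lt => e e0.
(* Where [psi y] is finite, [psi y > - ln e] says that the weight is below [e]. *)
move/cvgeyPgtr : cy => /(_ (- ln e) (num_real _)); apply: filterS => y Hy.
rewrite sub0r normrN ger0_norm ?weight_ge0//.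
have [fy|fy] := boolP (fin y); last by rewrite (weight_nfin psiN).
rewrite weight_fin// -[ltRHS](lnK e0) ltr_expR ltrNl.
by rewrite -lte_fin fineK.
Unshelve. all: by end_near.
Qed.

Lemma continuous_fin_near (x : T) :
  {for x, continuous psi} -> fin x -> \forall y \near x, fin y.
Proof.
move=> cx fx; have cx' : psi y @[y --> x] --> (r x)%:E by rewrite /= fineK.
by have [] := (fine_cvgP _ _).1 cx'.
Qed.

End continuous_weight.

Section weight_rV.
Context (R : realType) (n : nat).
Variable psi : 'rV[R]_n -> \bar R.
Hypothesis psiN : forall x, psi x != -oo%E.

Local Notation weight := (weight psi).
Local Notation fin x := (psi x \is a fin_num).
Local Notation r := (fine \o psi).

Lemma measurable_weight : measurable_fun [set: 'rV[R]_n] psi ->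
  measurable_fun [set: 'rV[R]_n] weight.
Proof.
move=> mpsi.
rewrite (_ : weight = fun x => if fin x then expR (- r x) else 0); last first.
  by apply/funext => x; case: ifPn => fx; [exact: weight_fin|exact: (weight_nfin psiN)].
apply: measurable_fun_ifT => //.
  apply: (measurable_fun_bool true); rewrite setTI.
  rewrite (_ : _ @^-1` _ = [set x | fin x]); last by apply/seteqP; split.
  by rewrite -[X in measurable X]setTI; exact: emeasurable_fin_num.
apply: measurableT_comp => //; apply: measurableT_comp => //.
exact: measurableT_comp.
Qed.

(** Log-concavity at midpoints, squared to avoid roots; an infinite value makes the left side 0. *)
Lemma weight_midpoint x z : convex_efun psi ->
  weight x * weight z <= weight (2^-1 *: (x + z)) ^+ 2.
Proof.
move=> [_ cvx].
have [fx|fx] := boolP (fin x); last by rewrite (weight_nfin psiN)// mul0r sqr_ge0.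
have [fz|fz] := boolP (fin z); last by rewrite [X in _ * X](weight_nfin psiN)// mulr0 sqr_ge0.
have h2 : 0 <= (2^-1 : R) <= 1 by rewrite invr_ge0 ler0n invf_le1 ?ltr0n// ler1n.
have := cvx x z 2^-1 h2.
have -> : 2^-1 *: x + (1 - 2^-1) *: z = 2^-1 *: (x + z).
  by apply/rowP => j; rewrite !mxE; field.
rewrite -(fineK fx) -(fineK fz) -!EFinM -EFinD => H.
have fm : fin (2^-1 *: (x + z)).
  by rewrite fin_numE psiN/= -ltey (le_lt_trans H)// ltry.
move: H; rewrite -(fineK fm) lee_fin => H.
rewrite !weight_fin// -expRD expr2 -expRD ler_expR /=; lra.
Qed.

End weight_rV.

Section fibers.
Context (R : realType) (m : nat).
Variable psi : 'rV[R]_m.+1 -> \bar R.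

Local Notation e_ i := (delta_mx ord0 i : 'rV[R]_m.+1).

Lemma insE (i : 'I_m.+1) t (y : 'rV[R]_m) : ins i (t, y) = ins i (0, y) + t *: e_ i.
Proof.
apply/rowP => j; rewrite !mxE eqxx/=; case: (unliftP i j) => [k|] ->.
  by rewrite eq_sym (negbTE (neq_lift _ _)) mulr0 addr0.
by rewrite eqxx mulr1 add0r.
Qed.

Lemma insD (i : 'I_m.+1) t u (y : 'rV[R]_m) : ins i (t + u, y) = ins i (t, y) + u *: e_ i.
Proof. by rewrite insE (insE i t) scalerDl addrA. Qed.

Lemma continuous_ins i (y : 'rV[R]_m) (t : R) :
  ins i (u, y) @[u --> t] --> ins i (t, y).
Proof.
rewrite insE; under eq_fun do rewrite insE.
by apply: cvgD; [exact: cvg_cst|exact: scalel_continuous].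
Qed.

Definition fiber i (y : 'rV[R]_m) (t : R) : \bar R := psi (ins i (t, y)).

Lemma convex1_fiber i y : convex_efun psi -> convex1 (fiber i y).
Proof.
move=> cpsi; rewrite (_ : fiber i y = line psi i (ins i (0, y))).
  exact: convex1_line.
by apply/funext => t; rewrite /fiber insE.
Qed.

Lemma side_deriv_fiber s i y t :
  side_deriv s (fiber i y) t = partial psi s i (ins i (t, y)).
Proof.
rewrite /partial /side_deriv; congr (fine (limn_esup _)); apply/funext => k.
by rewrite /diff_quot /fiber /line insD add0r scale0r addr0.
Qed.

Lemma continuous_weight_fiber i y : (forall x, psi x != -oo%E) ->
  (forall t, {for ins i (t, y), continuous psi}) -> continuous (weight (fiber i y)).
Proof.
move=> psiN c t.
exact: (cvg_comp _ _ (@continuous_ins i y t) (continuous_weight psiN (c t))).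
Qed.

End fibers.

(** * Bounds from log-concavity and integrability of the partial derivatives *)

Section bounds.
Context (R : realType) (m : nat).
Variable psi : 'rV[R]_m.+1 -> \bar R.
Local Notation leb := (@lebesgue_measure R).
Local Notation lebn := (lebesgue_rV R m.+1).
Local Notation lebm := (lebesgue_rV R m).
Local Notation F := (weight psi).
Hypothesis cpsi : convex_efun psi.
Hypothesis lpsi : lower_semicontinuous psi.
Hypothesis hpsi : hausdorff_measure m%:R [set x | ~ {for x, continuous psi}] = 0%E.
Hypothesis I0 : (0 < \int[lebn]_x (F x)%:E)%E.
Hypothesis Ioo : (\int[lebn]_x (F x)%:E < +oo)%E.

Let psiN : forall x, psi x != -oo%E. Proof. by case: cpsi. Qed.
Let mpsi : measurable_fun [set: 'rV[R]_m.+1] psi. Proof. exact: measurable_lsc. Qed.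
Let mF : measurable_fun [set: 'rV[R]_m.+1] F. Proof. exact: measurable_weight. Qed.
Let F0 x : 0 <= F x. Proof. exact: weight_ge0. Qed.
Let mFE : measurable_fun [set: 'rV[R]_m.+1] (fun x => (F x)%:E).
Proof. exact/measurable_EFinP. Qed.

Definition good_fiber i y := (forall t, {for ins i (t, y), continuous psi}) /\
  (\int[leb]_t (F (ins i (t, y)))%:E < +oo)%E.

Lemma ae_good_fiber i : {ae lebm, forall y, good_fiber i y}.
Proof.
have H1 : {ae lebm, forall y, forall t, {for ins i (t, y), continuous psi}}.
  have := negligible_hausdorff_null i hpsi; apply: negligibleS => y /= /existsNP[t Dt].
  by exists (ins i (t, y)) => //; rewrite del_ins.
have H2 : {ae lebm, forall y, (\int[leb]_t (F (ins i (t, y)))%:E < +oo)%E}.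
  have : lebm.-integrable setT (fun y => \int[leb]_t (F (ins i (t, y)))%:E)%E.
    apply/integrableP; split.
      by apply: (measurable_fun_tonelli_rV i mFE) => x; rewrite lee_fin.
    rewrite (eq_integral (fun y => \int[leb]_t (F (ins i (t, y)))%:E)%E).
      by have := Ioo; rewrite (tonelli_rV i mFE)// => x; rewrite lee_fin.
    by move=> y _; rewrite gee0_abs// integral_ge0// => t _; rewrite lee_fin.
  move/integrable_ae => /(_ measurableT); apply: filterS => y /(_ I).
  by move=> yfin; rewrite ltey_eq yfin.
by apply: filterS2 H1 H2 => y ? ?; split.
Qed.

(** The discontinuity set lies in the cylinder over its own projection, which is null. *)
Lemma ae_continuous : {ae lebn, forall x, {for x, continuous psi}}.
Proof.
have := negligible_del ord0 (negligible_hausdorff_null ord0 hpsi).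
by apply: negligibleS => x /= Dx; exists x.
Qed.

Lemma integral_weight_gt0_ae0 : ~ {ae lebn, forall x, F x = 0}.
Proof.
move=> H; move: I0; rewrite (_ : \int[lebn]_x (F x)%:E = 0)%E ?ltxx//.
rewrite (ae_eq_integral (cst 0%E))//; first by rewrite integral0.
by apply: filterS H => x -> _.
Qed.

(** The weight is positive on a set that is not null, and almost every point is a continuity point,
    so some [x0] is both; continuity keeps the weight above [F x0 / 2] nearby. *)
Lemma weight_ge_ball : exists x0 : 'rV[R]_m.+1, exists c d : R,
  [/\ 0 < c, 0 < d & forall z : 'rV[R]_m.+1, (forall j, `|z ord0 j - x0 ord0 j| < d) -> c <= F z].
Proof.
have [x0 [F1 c1]] : exists x0, 0 < F x0 /\ {for x0, continuous psi}.
  apply: contrapT => H; apply: integral_weight_gt0_ae0.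
  apply: filterS ae_continuous => x cx; apply: contrapT => Fx; apply: H.
  by exists x; split => //; rewrite lt_neqAle F0 andbT eq_sym; exact/eqP.
have c2 := continuous_weight psiN c1.
have F2 : F x0 / 2 < F x0 by rewrite ltr_pdivrMr// ltr_pMr// ltr1n.
have : nbhs (x0 : 'rV[R]_m.+1) [set z | F x0 / 2 < F z].
  exact: (cvgr_gt _ c2 _ F2).
move/nbhs_ballP => [d /= d0 Hd].
exists x0, (F x0 / 2), d; split => //; first by rewrite divr_gt0.
move=> z zd; apply/ltW/Hd; split => // i j.
by rewrite (ord1 i) /ball/= distrC.
Qed.

Lemma integral_cst_cube (c e : R) (w : 'rV[R]_m.+1) : 0 <= c -> 0 < e ->
  (\int[lebn]_x (c * \1_[set z : 'rV[R]_m.+1 | forall j, ball (w ord0 j) e (z ord0 j)] x)%:E =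
  (c * (2 * e) ^+ m.+1)%:E)%E.
Proof.
move=> c0 e0; set Q := [set z | _].
have mQ : measurable Q.
  apply: (@measurable_box R m.+1 (fun j => ball (w ord0 j) e)) => j.
  exact: measurable_ball.
under eq_integral do rewrite EFinM.
rewrite ge0_integralZl//; last by apply/measurable_EFinP; exact: measurable_indic.
rewrite EFinM; congr (_ * _)%E; rewrite integral_indic// setIT.
apply: etrans (lebesgue_rV_box (A := fun j => ball (w ord0 j) e) _) _.
  by move=> j; exact: measurable_ball.
under eq_bigr do rewrite lebesgue_measure_ball ?(ltW e0)//.
by rewrite prodEFin/= big_const_ord iter_mulr_1 mulr_natl.
Qed.

(** The midpoints of [x] with the cube of half-side [d] around [x0] fill a cube of half-side [d / 2]
    and volume [V], on which the weight is at least [sqrt (c F x)]. Hence [V * sqrt (c F x)] is at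
    most the total mass [A]. *)
Lemma weight_bounded : exists2 M, 0 < M & forall x, F x <= M.
Proof.
have [x0 [c [d [c0 d0 Hc]]]] := weight_ge_ball.
pose A := fine (\int[lebn]_x (F x)%:E)%E.
have AE : (\int[lebn]_x (F x)%:E)%E = A%:E.
  by rewrite /A fineK// ge0_fin_numE// ltW.
have A0 : 0 < A by rewrite -lte_fin -AE.
have d2 : 0 < d / 2 by rewrite divr_gt0.
pose V := (2 * (d / 2)) ^+ m.+1; have V0 : 0 < V by rewrite exprn_gt0// mulr_gt0.
exists ((A / V) ^+ 2 / c); first by rewrite divr_gt0// exprn_gt0// divr_gt0.
move=> x; rewrite ler_pdivlMr//.
pose q := Num.sqrt (F x * c).
have Fc0 : 0 <= F x * c by rewrite mulr_ge0// ltW.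
have q0 : 0 <= q by exact: sqrtr_ge0.
rewrite -(sqr_sqrtr Fc0) -/q ler_sqr ?nnegrE ?divr_ge0 ?(ltW A0) ?(ltW V0)//.
rewrite ler_pdivlMr// -lee_fin -AE -(integral_cst_cube (2^-1 *: (x + x0)) q0 d2).
apply: ge0_le_integral => //.
- by move=> y _; rewrite lee_fin mulr_ge0.
- apply/measurable_EFinP; apply: measurable_funM => //; apply: measurable_indic.
  apply: (@measurable_box R m.+1 (fun j => ball ((2^-1 *: (x + x0)) ord0 j) (d / 2))) => j.
  exact: measurable_ball.
- move=> w _; rewrite lee_fin indicE; case: (boolP (w \in _)) => [|_]; last first.
    by rewrite mulr0.
  rewrite inE/= mulr1 => Hw.
  pose z := 2 *: w - x.
  have wE : w = 2^-1 *: (x + z).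
    by apply/rowP => j; rewrite !mxE; field.
  have := weight_midpoint psiN x z cpsi; rewrite -wE.
  have Fz : c <= F z.
    apply: Hc => j; have := Hw j; rewrite /ball/= !mxE !ltr_norml => /andP[h1 h2].
    by apply/andP; split; lra.
  move=> H; rewrite -(ler_sqr) ?nnegrE//.
  rewrite sqr_sqrtr//; apply: le_trans H.
  by rewrite ler_wpM2l.
Qed.

(* The midpoints of the point of height [t] above [y] with a segment on which the
   weight is bounded below fill a segment of the fibre over [(y + y0) / 2], where
   log-concavity bounds the weight below by a multiple of its value at that point. *)
Lemma weight_le_midfiber i : exists2 k : R, 0 < k & exists y0 : 'rV[R]_m,
  forall y t, ((k * F (ins i (t, y)))%:E <=
    \int[leb]_u (F (ins i (u, 2^-1 *: y + 2^-1 *: y0)))%:E)%E.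
Proof.
have [x0 [c [d [c0 d0 Hc]]]] := weight_ge_ball.
have [M M0 FM] := weight_bounded.
(* Log-concavity alone bounds the weight at the midpoint below by a root, [sqrt (c F)]. Since
   [F <= M], this is at least [sqrt (c / M) * F], which is linear in [F]. The other factor [d / 2]
   is the length [b - a]. *)
pose kap := Num.sqrt (c / M); have kap0 : 0 < kap by rewrite sqrtr_gt0 divr_gt0.
exists (kap * (d / 2)); first by rewrite mulr_gt0// divr_gt0.
exists (del i x0) => y t; set y1 := _ + _.
pose a := (t + x0 ord0 i) / 2 - d / 4; pose b := (t + x0 ord0 i) / 2 + d / 4.
have ab : a <= b by rewrite /a /b; lra.
have -> : kap * (d / 2) * F (ins i (t, y)) = kap * F (ins i (t, y)) * (b - a).
  by rewrite /a /b; field.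
have kF0 : 0 <= kap * F (ins i (t, y)) by rewrite mulr_ge0// ltW.
rewrite -(integral_cst_itv kF0 ab).
have mline : measurable_fun [set: R] (fun u => F (ins i (u, y1))).
  exact: (measurableT_comp mF (measurable_ins_line i y1)).
apply: ge0_le_integral => //.
- by move=> u _; rewrite lee_fin mulr_ge0.
- by apply: measurable_EFin_comp; exact: measurable_funM.
- exact: measurable_EFin_comp.
- move=> u _; rewrite lee_fin indicE; case: (boolP (u \in _)) => [|_]; last first.
    by rewrite mulr0.
  rewrite inE/= in_itv/= mulr1 /a /b => /andP[u1 u2].
  pose z := ins i (2 * u - t, del i x0).
  have Fz : c <= F z.
    apply: Hc => j; rewrite /z; case: (unliftP i j) => [k|] ->.
      by rewrite ins_lift mxE subrr normr0.
    by rewrite ins_id/= ltr_norml; apply/andP; split; lra.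
  have zE : 2^-1 *: (ins i (t, y) + z) = ins i (u, y1).
    apply/rowP => j; rewrite !mxE; case: unliftP => [k|] _ /=; rewrite ?mxE.
      by rewrite mulrDr.
    by field.
  have := weight_midpoint psiN (ins i (t, y)) z cpsi; rewrite zE => H.
  rewrite -ler_sqr ?nnegrE// exprMn sqr_sqrtr; last by rewrite divr_ge0// ltW.
  apply: le_trans H; rewrite mulrAC ler_pdivrMr// expr2 mulrA mulrC.
  have FMx := FM (ins i (t, y)); set f := F _ in FMx *.
  have f0 : 0 <= f := F0 _.
  apply: (@le_trans _ _ (c * f * M)); first by rewrite mulrC ler_wpM2l// mulr_ge0// ltW.
  by rewrite ler_wpM2r ?(ltW M0)// mulrC ler_wpM2l.
Qed.

Lemma integral_midfiber i (y0 : 'rV[R]_m) :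
  (\int[lebm]_y \int[leb]_u (F (ins i (u, 2^-1 *: y + 2^-1 *: y0)%R))%:E < +oo)%E.
Proof.
have mh := measurable_fun_tonelli_rV i mFE (fun x => F0 x).
have h0 (y : 'rV[R]_m) : (0 <= \int[leb]_u (F (ins i (u, y)))%:E)%E.
  by apply: integral_ge0 => u _; rewrite lee_fin.
have i2 : 0 < (2^-1 : R) by rewrite invr_gt0.
have := ge0_integral_affine_rV (2^-1 *: y0) i2 mh h0.
rewrite -(tonelli_rV i mFE)// => E.
have : ((2 ^+ m)%:E * \int[lebn]_x (F x)%:E < +oo)%E.
  by rewrite lte_mul_pinfty// lee_fin exprn_ge0.
rewrite E muleA -EFinM exprVn mulfV ?mul1e// expf_neq0//.
Qed.

(** On a good line the integral is at most twice any upper bound of the weight, and [B y / k] is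
    one. Being an integral, [B] is measurable in [y] and stands in for the maximum over the line. *)
Lemma integral_partial_weight s i :
  (\int[lebn]_x (`|partial psi s i x * F x|)%:E < +oo)%E.
Proof.
have mP := measurable_partial lpsi s i.
have mPF : measurable_fun [set: 'rV[R]_m.+1] (fun x => (`|partial psi s i x * F x|)%:E).
  apply/measurable_EFinP; apply: measurableT_comp => //.
  exact: measurable_funM.
have [k k0 [y0 H]] := weight_le_midfiber i.
rewrite (tonelli_rV i mPF)//.
pose B y := (\int[leb]_u (F (ins i (u, 2^-1 *: y + 2^-1 *: y0)))%:E)%E.
have B0 y : (0 <= B y)%E by apply: integral_ge0 => u _; rewrite lee_fin.
have mB : measurable_fun [set: 'rV[R]_m] B.
  apply: (@measurableT_comp _ _ _ _ _ _ (fun y => \int[leb]_u (F (ins i (u, y)))%:E)%E).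
    exact: (measurable_fun_tonelli_rV i mFE (fun x => F0 x)).
  apply: measurable_fun_rowP => j; under eq_fun do rewrite !mxE.
  by apply: measurable_funD => //; apply: measurable_funM => //; exact: measurable_coord.
apply: (@le_lt_trans _ _ (\int[lebm]_y ((2 / k)%:E * B y))%E).
  apply: ae_ge0_le_integral => //.
  - by move=> y _; apply: integral_ge0 => t _; rewrite lee_fin.
  - exact: (measurable_fun_tonelli_rV i mPF (fun x => normr_ge0 _)).
  - by move=> y _; rewrite mule_ge0// lee_fin divr_ge0// ltW.
  - exact: measurable_funeM.
  - apply: filterS (ae_good_fiber i) => y [cy iy] _.
    have [By|By] := eqVneq (B y) +oo%E.
      by rewrite By gt0_muley ?leey// lte_fin divr_gt0.
    have BE : B y = (fine (B y))%:E by rewrite fineK// ge0_fin_numE// ltey.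
    have FB t : weight (fiber psi i y) t <= fine (B y) / k.
      by rewrite ler_pdivlMr// mulrC -lee_fin -BE; exact: H.
    have mfib : measurable_fun [set: R] (fiber psi i y).
      exact: (measurableT_comp mpsi (measurable_ins_line i y)).
    have K := @integral_side_deriv_le R (fiber psi i y) (convex1_fiber i y cpsi) mfib
      (continuous_weight_fiber psiN cy) iy s _ FB.
    under eq_integral do rewrite -side_deriv_fiber.
    apply: (le_trans K).
    by rewrite BE -EFinM lee_fin; rewrite le_eqVlt; apply/orP; left; apply/eqP; ring.
rewrite ge0_integralZl//; last by rewrite lee_fin divr_ge0// ltW.
rewrite lte_mul_pinfty// ?lee_fin ?divr_ge0// ?(ltW k0)//.
exact: integral_midfiber.
Qed.

End bounds.

(** * Integration by parts and the moment measure *)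

Section atan_facts.
Context (R : realType).

Lemma atan_lipschitz (x y : R) : `|atan x - atan y| <= 1 * `|x - y|.
Proof.
rewrite mul1r; wlog xy : x y / x <= y.
  move=> H; have [|/ltW yx] := leP x y; first exact: H.
  by rewrite distrC [in leRHS]distrC; exact: H.
have [c _ E] := @MVT_segment R atan (fun t => (1 + t ^+ 2)^-1) x y xy
  (fun t _ => is_derive1_atan t) (continuous_subspaceT (@continuous_atan R)).
rewrite distrC (distrC x) E normrM ler_piMl// ger0_norm ?invr_ge0 ?addr_ge0 ?sqr_ge0//.
by rewrite invf_le1 ?ltr_pwDl ?sqr_ge0// lerDl sqr_ge0.
Qed.

Lemma atan_quotient s (t : R) :
  (atan (t + step R s k) - atan t) / step R s k @[k --> \oo] --> (1 + t ^+ 2)^-1.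
Proof.
have [d <-] := is_derive1_atan t.
have cs : step R s @ \oo --> (0 : R)^'.
  move=> A [e /= e0 Ae].
  have /cvgrPdist_lt/(_ _ e0) := @cvg_step R s; apply: filterS => k ke.
  by apply: Ae => //; exact: step_neq0.
have := cvg_comp _ _ cs d.
apply: cvg_trans; rewrite (_ : (fun _ => _) =
  (fun h => h^-1 *: ((atan \o shift t) (h *: 1) - atan t)) \o step R s)//.
apply/funext => k /=.
have -> : (step R s k)%:A = step R s k := mulr1 _.
by rewrite (addrC t) [LHS]mulrC.
Qed.

Lemma norm_atan_le (t : R) : `|atan t| <= pi / 2.
Proof. by rewrite ler_norml !ltW// (atan_gtNpi2, atan_ltpi2). Qed.

End atan_facts.

Section integration_by_parts.
Context (R : realType) (m : nat).
Variable psi : 'rV[R]_m.+1 -> \bar R.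
Local Notation leb := (@lebesgue_measure R).
Local Notation lebn := (lebesgue_rV R m.+1).
Local Notation lebm := (lebesgue_rV R m).
Local Notation F := (weight psi).
Hypothesis cpsi : convex_efun psi.
Hypothesis lpsi : lower_semicontinuous psi.
Hypothesis hpsi : hausdorff_measure m%:R [set x | ~ {for x, continuous psi}] = 0%E.
Hypothesis I0 : (0 < \int[lebn]_x (F x)%:E)%E.
Hypothesis Ioo : (\int[lebn]_x (F x)%:E < +oo)%E.

Let psiN : forall x, psi x != -oo%E. Proof. by case: cpsi. Qed.
Let mpsi : measurable_fun [set: 'rV[R]_m.+1] psi. Proof. exact: measurable_lsc. Qed.
Let mF : measurable_fun [set: 'rV[R]_m.+1] F. Proof. exact: measurable_weight. Qed.
Let F0 x : 0 <= F x. Proof. exact: weight_ge0. Qed.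

Lemma integrable_weight : lebn.-integrable setT (fun x => (F x)%:E).
Proof.
apply/integrableP; split; first exact/measurable_EFinP.
by under eq_integral do rewrite /= ger0_norm//.
Qed.

Lemma integrable_partial_weight s i :
  lebn.-integrable setT (fun x => (partial psi s i x * F x)%:E).
Proof.
apply/integrableP; split; last exact: integral_partial_weight.
by apply/measurable_EFinP; apply: measurable_funM => //; exact: measurable_partial.
Qed.

Section test_function.
Variables (g g' : R -> R) (C G : R) (s : bool).
Hypothesis gC : forall t, `|g t| <= C.
Hypothesis gG : forall t t', `|g t - g t'| <= G * `|t - t'|.
Hypothesis gg' : forall t,
  (g (t + step R s k) - g t) / step R s k @[k --> \oo] --> g' t.

Let g'G t : `|g' t| <= G.
Proof.
have := @gg' t => /cvg_norm c; rewrite -(cvg_lim _ c)//.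
apply: limr_le; first exact: cvgP c.
apply: nearW => k; rewrite normrM normfV ler_pdivrMr ?normr_gt0 ?step_neq0//.
have := gG (t + step R s k) t.
by rewrite (_ : t + step R s k - t = step R s k)// addrC addKr.
Qed.

Let mg : measurable_fun [set: R] g.
Proof. exact: lipschitz_measurable gG. Qed.

Let mg' : measurable_fun [set: R] g'.
Proof.
pose h k t := (g (t + step R s k) - g t) / step R s k.
apply: (measurable_fun_cvg (h := h)) => [k|t _]; last exact: gg'.
apply: measurable_funM => //; apply: measurable_funB => //.
by apply: measurableT_comp => //; exact: measurable_funD.
Qed.

Let integrable_mul_bounded (f : 'rV[R]_m.+1 -> R) (h : 'rV[R]_m.+1 -> R) (B : R) :
  lebn.-integrable setT (fun x => (f x)%:E) -> measurable_fun [set: 'rV[R]_m.+1] h ->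
  (forall x, `|h x| <= B) -> lebn.-integrable setT (fun x => (f x * h x)%:E).
Proof.
move=> fi mh hB.
have mf : measurable_fun [set: 'rV[R]_m.+1] f by apply/measurable_EFinP; exact: measurable_int fi.
apply: (@le_integrable _ _ _ lebn setT measurableT _ (fun x => B%:E * (f x)%:E)%E).
- by apply/measurable_EFinP; exact: measurable_funM.
- move=> x _; rewrite -EFinM !abse_EFin lee_fin !normrM mulrC ler_wpM2r//.
  exact: le_trans (hB x) (ler_norm B).
- exact: integrableZl.
Qed.

Lemma integrable_partial_test i j :
  lebn.-integrable setT (fun x => (partial psi s i x * F x * g (x ord0 j))%:E).
Proof.
apply: (@integrable_mul_bounded _ (fun x => g (x ord0 j)) C).
- exact: integrable_partial_weight.
- exact: (measurableT_comp mg (measurable_coord j)).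
- by move=> x; exact: gC.
Qed.

Lemma integrable_weight_test j : lebn.-integrable setT (fun x => (F x * g' (x ord0 j))%:E).
Proof.
apply: (@integrable_mul_bounded _ (fun x => g' (x ord0 j)) G).
- exact: integrable_weight.
- exact: (measurableT_comp mg' (measurable_coord j)).
- by move=> x; exact: g'G.
Qed.

(** Along direction [i] the coordinate [x_j] is the variable if [j = i] and a constant otherwise. On
    every good line the difference of the integrands integrates to 0; both sides being finite, it
    can be split afterwards. *)
Lemma integral_partial_test i j :
  (\int[lebn]_x (partial psi s i x * F x * g (x ord0 j))%:E =
   \int[lebn]_x (F x * (if j == i then g' (x ord0 j) else 0))%:E)%E.
Proof.
have i1 := integrable_partial_test i j.
have i2 : lebn.-integrable setT (fun x => (F x * (if j == i then g' (x ord0 j) else 0))%:E).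
  case: (j == i); first exact: integrable_weight_test.
  by under eq_fun do rewrite mulr0; exact: integrable0.
have E : (\int[lebn]_x (F x * (if j == i then g' (x ord0 j) else 0) -
    partial psi s i x * F x * g (x ord0 j))%:E = 0)%E.
  have iB : lebn.-integrable setT (fun x => (F x * (if j == i then g' (x ord0 j) else 0) -
      partial psi s i x * F x * g (x ord0 j))%:E).
    by under eq_fun do rewrite EFinB; exact: integrableB.
  rewrite (fubini_rV i)//.
  rewrite (ae_eq_integral (cst 0%E))//.
  - by rewrite integral0.
  - exact: measurable_fun_fubini_rV iB.
  - apply: filterS (ae_good_fiber cpsi lpsi hpsi Ioo i) => y [cy iy] _.
    have mfib : measurable_fun [set: R] (fiber psi i y).
      exact: (measurableT_comp mpsi (measurable_ins_line i y)).
    pose gy (t : R) := g (ins i (t, y) ord0 j).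
    pose gy' (t : R) := if j == i then g' (ins i (t, y) ord0 j) else 0.
    have K := @log_concave_ibp R (fiber psi i y) (convex1_fiber i y cpsi) mfib
      (continuous_weight_fiber psiN cy) iy s gy gy' C `|G|.
    rewrite -[RHS]K.
    + by apply: eq_integral => t _; rewrite side_deriv_fiber.
    + by move=> t; exact: gC.
    + move=> t t'; rewrite /gy; case: (unliftP i j) => [k|] ->.
        by rewrite !ins_lift subrr normr0 mulr_ge0.
      rewrite !ins_id; apply: (le_trans (gG _ _)).
      by rewrite ler_wpM2r// ler_norm.
    + move=> t; rewrite /gy /gy'; case: (unliftP i j) => [k|] ->.
        rewrite eq_sym (negbTE (neq_lift _ _)).
        under eq_fun do rewrite !ins_lift subrr mul0r.
        exact: cvg_cst.
      by rewrite eqxx; under eq_fun do rewrite !ins_id; rewrite ins_id; exact: gg'.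
move: E; under eq_integral do rewrite EFinB.
rewrite integralB// => /eqP; rewrite sube_eq ?add0e; first by move=> /eqP ->.
- exact: integrable_fin_num.
- exact: fin_num_adde_defr.
Qed.

End test_function.

Lemma integral_partial_weight0 s i : (\int[lebn]_x (partial psi s i x * F x)%:E = 0)%E.
Proof.
have h1 (t : R) : `|(fun=> 1) t : R| <= 1 by rewrite normr1.
have h2 (t t' : R) : `|(fun=> 1) t - (fun=> 1) t' : R| <= 0 * `|t - t'|.
  by rewrite subrr normr0 mul0r.
have h3 (t : R) : ((fun=> 1) (t + step R s k) - (fun=> 1) t : R) / step R s k
    @[k --> \oo] --> (fun=> 0 : R) t.
  by under eq_fun do rewrite subrr mul0r; exact: cvg_cst.
have := integral_partial_test h1 h2 h3 i i.
under eq_integral do rewrite mulr1.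
by rewrite eqxx; under [RHS]eq_integral do rewrite mulr0; rewrite integral0.
Qed.

(** By convexity the right derivative exceeds the left one wherever [psi] is finite and continuous.
    A nonnegative function with integral 0 vanishes almost everywhere. *)
Lemma ae_partial_eq i :
  {ae lebn, forall x, (partial psi false i x - partial psi true i x) * F x = 0}.
Proof.
pose D x := (partial psi false i x - partial psi true i x) * F x.
have mD : measurable_fun [set: 'rV[R]_m.+1] (fun x => (D x)%:E).
  apply/measurable_EFinP; apply: measurable_funM => //.
  by apply: measurable_funB; exact: measurable_partial.
have ID : (\int[lebn]_x (D x)%:E = 0)%E.
  rewrite /D; under eq_integral do rewrite mulrBl EFinB.
  by rewrite integralB//= ?integral_partial_weight0 ?sube0//; exact: integrable_partial_weight.
have D0 : {ae lebn, forall x, 0 <= D x}.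
  apply: filterS (ae_continuous hpsi) => x cx.
  have [fx|fx] := boolP (psi x \is a fin_num); last first.
    by rewrite /D (weight_nfin psiN fx) mulr0.
  rewrite /D mulr_ge0// subr_ge0; apply: side_deriv_le; first exact: convex1_line.
  exact: near_line (continuous_fin_near cx fx).
have IA : (\int[lebn]_x `|(D x)%:E| = 0)%E.
  rewrite -[RHS]ID; apply: ae_eq_integral => //; first exact: measurableT_comp.
  by apply: filterS D0 => x Dx _; rewrite gee0_abs.
have /(ae_eq_integral_abs _ measurableT mD) := IA.
by apply: filterS => x /(_ I)[].
Qed.

Lemma ae_edifferentiable : {ae lebn, forall x, 0 < F x -> edifferentiable psi x}.
Proof.
have H : {ae lebn, forall x, forall i, (partial psi false i x - partial psi true i x) * F x = 0}.
  by apply: filter_forall => i; exact: ae_partial_eq.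
apply: filterS2 (ae_continuous hpsi) H => x cx Hx Fx.
apply/(edifferentiableP cpsi x (ltn0Sn m)); split.
  by apply: (continuous_fin_near cx); rewrite -weight_gt0.
move=> i; have /eqP := Hx i; rewrite mulf_eq0 (gt_eqF Fx) orbF subr_eq0.
by move=> /eqP.
Qed.

(** The factor [F] absorbs the points off the domain, where [gradient] and [partial] take values
    that need not agree. *)
Lemma ae_gradient : {ae lebn, forall x, forall i,
  gradient psi x ord0 i * F x = partial psi false i x * F x}.
Proof.
apply: filterS ae_edifferentiable => x Hx i.
have [Fx|Fx] := ltP 0 (F x); last first.
  by have -> : F x = 0 by [apply/eqP; rewrite eq_le Fx F0]; rewrite !mulr0.
rewrite /gradient; case: pselect => [dx|ndx]; last by exfalso; exact: (ndx (Hx Fx)).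
by rewrite mxE (edifferentiable_partial cpsi _ _ dx).
Qed.

End integration_by_parts.

(** * Barycenter and support of the moment measure *)

Section moment.
Context (R : realType) (m : nat).
Variable psi : 'rV[R]_m.+1 -> \bar R.
Local Notation lebn := (lebesgue_rV R m.+1).
Local Notation F := (weight psi).
Hypothesis cpsi : convex_efun psi.
Hypothesis lpsi : lower_semicontinuous psi.
Hypothesis hpsi : hausdorff_measure m%:R [set x | ~ {for x, continuous psi}] = 0%E.
Hypothesis I0 : (0 < \int[lebn]_x (F x)%:E)%E.
Hypothesis Ioo : (\int[lebn]_x (F x)%:E < +oo)%E.

Let psiN : forall x, psi x != -oo%E. Proof. by case: cpsi. Qed.
Let mpsi : measurable_fun [set: 'rV[R]_m.+1] psi. Proof. exact: measurable_lsc. Qed.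
Let mF : measurable_fun [set: 'rV[R]_m.+1] F. Proof. exact: measurable_weight. Qed.
Let F0 x : 0 <= F x. Proof. exact: weight_ge0. Qed.
Let mgrad : measurable_fun [set: 'rV[R]_m.+1] (gradient psi).
Proof. exact: measurable_gradient. Qed.
Let mgradi i : measurable_fun [set: 'rV[R]_m.+1] (fun x => gradient psi x ord0 i).
Proof. exact: (measurableT_comp (measurable_coord i) mgrad). Qed.

Let exp_measureE A : exp_measure psi A = (\int[lebn]_(x in A) (F x)%:E)%E.
Proof. by apply: eq_integral => x _; rewrite weightE. Qed.

Let exp0 : exp_measure psi set0 = 0%E.
Proof. exact: integral_set0. Qed.

Let exp_ge0 A : (0 <= exp_measure psi A)%E.
Proof. by apply: integral_ge0 => x _; exact: expeR_ge0. Qed.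

Let exp_sigma_additive : semi_sigma_additive (exp_measure psi).
Proof.
rewrite (_ : exp_measure psi = fun A => (\int[lebn]_(x in A) (F x)%:E)%E); last first.
  by apply/funext => A; exact: exp_measureE.
by apply: semi_sigma_additive_nng_induced => //; exact/measurable_EFinP.
Qed.

(** [exp_measure psi] and [moment_measure psi] are bare set functions; [nu] and [mu] are the same
    functions with their measure structure, so results on measures apply to them by conversion. *)
Let nu : {measure set 'rV[R]_m.+1 -> \bar R} :=
  HB.pack (exp_measure psi) (isMeasure.Build _ _ _ (exp_measure psi) exp0 exp_ge0 exp_sigma_additive).

Let mu : {measure set 'rV[R]_m.+1 -> \bar R} :=
  measure_function_pushforward__canonical__measure_function_Measure nu mgrad.

Let muE : mu = moment_measure psi :> (set _ -> _). Proof. by []. Qed.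

Let nuE A : measurable A -> (nu A = \int[lebn]_(x in A) (F x)%:E)%E.
Proof. by move=> _; exact: exp_measureE. Qed.

Lemma ge0_integral_moment (h : 'rV[R]_m.+1 -> R) : measurable_fun [set: 'rV[R]_m.+1] h ->
  (forall y, 0 <= h y) ->
  (\int[moment_measure psi]_y (h y)%:E = \int[lebn]_x (h (gradient psi x) * F x)%:E)%E.
Proof.
move=> mh h0.
apply: etrans (ge0_integral_pushforward mgrad nu measurableT _ _) _.
- exact/measurable_EFinP.
- by move=> y _; rewrite lee_fin.
rewrite preimage_setT; apply: integral_density mF F0 nuE _ _.
exact: measurableT_comp mh mgrad.
Qed.

Lemma integral_moment_norm i :
  (\int[moment_measure psi]_y (`|y ord0 i|)%:E < +oo)%E.
Proof.
rewrite ge0_integral_moment//; last first.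
  by apply: measurableT_comp => //; exact: measurable_coord.
rewrite (ae_eq_integral (fun x => (`|partial psi false i x * F x|)%:E))//.
- exact: integral_partial_weight.
- apply/measurable_EFinP; apply: measurable_funM => //.
  exact: measurableT_comp.
- apply/measurable_EFinP; apply: measurableT_comp => //; apply: measurable_funM => //.
  exact: measurable_partial.
- apply: filterS (ae_gradient cpsi lpsi hpsi I0 Ioo) => x /(_ i) E _.
  by rewrite -E normrM (ger0_norm (F0 x)).
Qed.

Lemma enorm_le_sum (y : 'rV[R]_m.+1) : enorm y <= \sum_i `|y ord0 i|.
Proof.
rewrite /enorm -[leRHS]ger0_norm ?sumr_ge0// -sqrtr_sqr ler_sqrt ?sqr_ge0//.
rewrite /dotr expr2 big_distrl/=; apply: ler_sum => i _.
rewrite -expr2 -real_normK ?num_real// expr2 ler_wpM2l//.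
by rewrite (bigD1 i)//= lerDl sumr_ge0.
Qed.

Lemma measurable_enorm : measurable_fun [set: 'rV[R]_m.+1] (@enorm R m.+1).
Proof.
apply: (measurableT_comp (continuous_measurable_fun (@sqrt_continuous R))).
apply: measurable_sum => i; apply: measurable_funM; exact: measurable_coord.
Qed.

Lemma finite_first_moment_moment : finite_first_moment (moment_measure psi).
Proof.
rewrite /finite_first_moment -muE.
have i1 : mu.-integrable setT (fun y => \sum_i (`|y ord0 i|)%:E)%E.
  apply: integrable_sum => // i _; apply/integrableP; split.
    by apply/measurable_EFinP; apply: measurableT_comp => //; exact: measurable_coord.
  under eq_integral do rewrite /= normr_id.
  exact: integral_moment_norm.
apply: le_integrable i1 => //.
  by apply/measurable_EFinP; exact: measurable_enorm.
move=> y _; rewrite sumEFin !abse_EFin lee_fin.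
rewrite ger0_norm ?sqrtr_ge0// ger0_norm ?sumr_ge0//; exact: enorm_le_sum.
Qed.

Lemma barycenter_moment : barycenter (moment_measure psi) = 0.
Proof.
apply/rowP => i; rewrite !mxE.
suff -> : (\int[moment_measure psi]_y (y ord0 i)%:E = 0)%E by rewrite mulr0.
have i1 : nu.-integrable setT (fun x => (gradient psi x ord0 i)%:E).
  apply/integrableP; split; first exact/measurable_EFinP.
  have := integral_moment_norm i.
  rewrite ge0_integral_moment//; last first.
    by apply: measurableT_comp => //; exact: measurable_coord.
  rewrite -(integral_density mF F0 nuE)//; exact: measurableT_comp.
apply: etrans (@integral_pushforward _ _ _ _ _ _ mgrad nu setT (fun y => (y ord0 i)%:E) _ i1 measurableT) _.
  by apply/measurable_EFinP; exact: measurable_coord.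
rewrite preimage_setT; apply: etrans (integral_density mF F0 nuE (mgradi i)) _.
rewrite -[RHS](integral_partial_weight0 cpsi lpsi hpsi I0 Ioo false i).
apply: ae_eq_integral => //.
- by apply/measurable_EFinP; exact: measurable_funM.
- by apply/measurable_EFinP; apply: measurable_funM => //; exact: measurable_partial.
- by apply: filterS (ae_gradient cpsi lpsi hpsi I0 Ioo) => x /(_ i) ->.
Qed.

Lemma not_supported_hyperplane (theta : 'rV[R]_m.+1) (c : R) : theta != 0 ->
  ~ supported_in (moment_measure psi) (hyperplane theta c).
Proof.
move=> th0 H.
have mdot : measurable_fun [set: 'rV[R]_m.+1] (fun x => dotr theta (gradient psi x)).
  apply: measurable_sum => i; apply: measurable_funM => //; exact: measurable_cst.
pose N := [set x | dotr theta (gradient psi x) <> c].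
have mN : measurable N.
  have := measurable_fun_eqr mdot (@measurable_cst _ _ _ _ setT c).
  move=> /(_ measurableT [set false] I).
  rewrite setTI; congr measurable; apply/seteqP; split => x /=.
    by move=> /negbT/eqP.
  by move=> /eqP/negbTE.
(* The complement of the hyperplane pulls back to [N], so [H] says that [F] integrates to 0 over
   [N]. *)
have aeN : {ae lebn, forall x, N x -> F x = 0}.
  have mFN : measurable_fun N (fun x => (F x)%:E).
    by apply: measurable_funTS; exact/measurable_EFinP.
  have : (\int[lebn]_(x in N) `|(F x)%:E| = 0)%E.
    under eq_integral do rewrite /= ger0_norm//.
    by rewrite -exp_measureE; exact: H.
  move=> /(ae_eq_integral_abs _ mN mFN).
  by apply: filterS => x H1 /H1[].
have aeP : {ae lebn, forall x,
    \sum_i theta ord0 i * (partial psi false i x * F x) = c * F x}.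
  apply: filterS2 aeN (ae_gradient cpsi lpsi hpsi I0 Ioo) => x Nx gx.
  under eq_bigr do rewrite -gx mulrA.
  rewrite -mulr_suml -/(dotr theta (gradient psi x)).
  have [->//|xc] := pselect (dotr theta (gradient psi x) = c).
  by rewrite Nx// !mulr0.
(* The identity [aeP] is tested against [g (x_j)]: after integration by parts only the term [i = j]
   of the sum survives. *)
have key (g g' : R -> R) (C G : R) j : (forall t, `|g t| <= C) ->
    (forall t t', `|g t - g t'| <= G * `|t - t'|) ->
    (forall t, (g (t + step R false k) - g t) / step R false k @[k --> \oo] --> g' t) ->
    (\int[lebn]_x (c * F x * g (x ord0 j))%:E =
     \int[lebn]_x (theta ord0 j * (F x * g' (x ord0 j)))%:E)%E.
  move=> gC gG gg'.
  have mg : measurable_fun [set: R] g by exact: lipschitz_measurable gG.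
  have ip i : lebn.-integrable setT
      (fun x => (partial psi false i x * F x * g (x ord0 j))%:E).
    exact: (integrable_partial_test cpsi lpsi hpsi I0 Ioo false gC gG).
  transitivity (\int[lebn]_x \sum_i ((theta ord0 i)%:E *
      (partial psi false i x * F x * g (x ord0 j))%:E))%E.
    apply: ae_eq_integral => //.
    - apply/measurable_EFinP; apply: measurable_funM; first exact: measurable_funM.
      exact: (measurableT_comp mg (measurable_coord j)).
    - apply: emeasurable_sum => i; apply: measurable_funeM; exact: measurable_int (ip i).
    - apply: filterS aeP => x <- _; rewrite mulr_suml -sumEFin.
      by apply: eq_bigr => i _; rewrite -EFinM !mulrA.
  rewrite integral_sum//=; last by move=> i; exact: integrableZl.
  under eq_bigr do rewrite integralZl//
    (integral_partial_test cpsi lpsi hpsi I0 Ioo gC gG gg').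
  rewrite (bigD1 j)//= eqxx big1 ?addr0 => [|i ij]; last first.
    rewrite eq_sym (negbTE ij); under eq_integral do rewrite mulr0.
    by rewrite integral0 mule0.
  under [RHS]eq_integral do rewrite EFinM.
  rewrite integralZl//.
  exact: (integrable_weight_test cpsi lpsi Ioo gG gg').
have c0 : c = 0.
  have h1 (t : R) : `|(fun=> 1) t : R| <= 1 by rewrite normr1.
  have h2 (t t' : R) : `|(fun=> 1) t - (fun=> 1) t' : R| <= 0 * `|t - t'|.
    by rewrite subrr normr0 mul0r.
  have h3 (t : R) : ((fun=> 1) (t + step R false k) - (fun=> 1) t : R) / step R false k
      @[k --> \oo] --> (fun=> 0 : R) t.
    by under eq_fun do rewrite subrr mul0r; exact: cvg_cst.
  have := key _ _ _ _ ord0 h1 h2 h3.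
  under eq_integral do rewrite mulr1 EFinM.
  under [RHS]eq_integral do rewrite !mulr0.
  rewrite integral0 integralZl//; last exact: integrable_weight.
  by move=> /eqP; rewrite mule_eq0 (gt_eqF I0) orbF eqe => /eqP.
have [j thj] : exists j, theta ord0 j != 0.
  apply: contrapT => Hn; move/eqP : th0; apply; apply/rowP => j; rewrite mxE.
  by apply/eqP/negPn/negP => thj; apply: Hn; exists j.
have := key atan (fun t => (1 + t ^+ 2)^-1) (pi / 2) 1 j (@norm_atan_le R)
  (@atan_lipschitz R) (@atan_quotient R false).
rewrite c0; under eq_integral do rewrite mul0r mul0r.
rewrite integral0 => /esym.
have mw : measurable_fun [set: 'rV[R]_m.+1] (fun x : 'rV[R]_m.+1 => (1 + (x ord0 j) ^+ 2)^-1).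
  have catan : continuous (fun t : R => (1 + t ^+ 2)^-1).
    move=> t; apply: cvgV; first by rewrite gt_eqF// ltr_pwDl ?sqr_ge0.
    by apply: cvgD; [exact: cvg_cst|exact: exprn_continuous].
  exact: (measurableT_comp (continuous_measurable_fun catan) (measurable_coord j)).
have w0 (x : 'rV[R]_m.+1) : 0 < (1 + (x ord0 j) ^+ 2)^-1.
  by rewrite invr_gt0 ltr_pwDl ?sqr_ge0.
under eq_integral do rewrite EFinM.
rewrite integralZl//.
  move/eqP; rewrite mule_eq0 eqe (negbTE thj)/= => /eqP E.
  apply: (integral_weight_gt0_ae0 cpsi lpsi I0).
  have mFw : measurable_fun [set: 'rV[R]_m.+1] (fun x => (F x * (1 + (x ord0 j) ^+ 2)^-1)%:E).
    by apply/measurable_EFinP; exact: measurable_funM.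
  have : (\int[lebn]_x `|(F x * (1 + (x ord0 j) ^+ 2)^-1)%:E| = 0)%E.
    rewrite -[RHS]E; apply: eq_integral => x _.
    by rewrite gee0_abs// lee_fin mulr_ge0// ltW.
  move=> /(ae_eq_integral_abs _ measurableT mFw); apply: filterS => x /(_ I)[] /eqP.
  by rewrite mulf_eq0 (gt_eqF (w0 x)) orbF => /eqP.
exact: (integrable_weight_test cpsi lpsi Ioo (@atan_lipschitz R) (@atan_quotient R false)).
Qed.

End moment.

Theorem proposition1 (R : realType) (n : nat) (hn : (0 < n)%N)
    (psi : 'rV[R]_n -> \bar R) :
  convex_efun psi ->
  essentially_continuous psi ->
  (0 < \int[lebesgue_rV R n]_x expeR (- psi x))%E ->
  (\int[lebesgue_rV R n]_x expeR (- psi x) < +oo)%E ->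
  (forall (theta : 'rV[R]_n) (c : R), theta != 0 ->
     ~ supported_in (moment_measure psi) (hyperplane theta c)) /\
  (finite_first_moment (moment_measure psi) /\
   barycenter (moment_measure psi) = 0).
Proof.
case: n hn psi => // m _ psi cpsi [lpsi hpsi] I0 Ioo.
have E : (\int[lebesgue_rV R m.+1]_x expeR (- psi x) =
    \int[lebesgue_rV R m.+1]_x (weight psi x)%:E)%E.
  by apply: eq_integral => x _; rewrite weightE//; case: cpsi.
rewrite E in I0 Ioo.
split; first by move=> theta c; exact: not_supported_hyperplane.
by split; [exact: finite_first_moment_moment|exact: barycenter_moment].
Qed.
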